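(* The values $b_{200}(25(5n+2)-26)$ and $p_{17}(5n+2)$ have the same parity for almost all $n\ge0$, and likewise $b_{200}(25(5n+4)-26)$ and $p_{17}(5n+4)$ have the same parity for almost all $n\ge 0$; here ''almost all'' means that the set of $n$ for which the parities differ has natural density zero.
   Context: $b_{200}(n)$ denotes the number of partitions of $n$ none of whose parts is divisible by $200$; equivalently $\sum_{n\ge0} b_{200}(n)q^n = \prod_{i\ge1}(1-q^{200i})/(1-q^i)$. $p_{17}(n)$ denotes the number of $17$-multipartitions of $n$, with $\sum_{n\ge0}p_{17}(n)q^n=\prod_{i\ge1}(1-q^i)^{-17}$. *)

(* Defs.v *)
From mathcomp Require Import all_boot all_order all_algebra.
From mathcomp Require Import all_classical all_reals all_analysis.

Set Implicit Arguments.
Unset Strict Implicit.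
Unset Printing Implicit Defensive.

Import Order.TTheory GRing.Theory Num.Theory.
Import numFieldNormedType.Exports.

Local Open Scope nat_scope.

Definition is_partition (s : seq nat) : bool :=
  sorted geq s && (0 \notin s).

Definition is_regular (l : nat) (s : seq nat) : bool :=
  all (fun x => ~~ (l %| x)) s.

(* Every partition of a number m <= n has at most n parts, each at most n, so
   the finite type {bseq n of 'I_n.+1} contains all of them. *)
Definition parts (n : nat) (s : {bseq n of 'I_n.+1}) : seq nat :=
  [seq nat_of_ord x | x <- s].

Definition num_regular_partitions (l n : nat) : nat :=
  #|[pred s : {bseq n of 'I_n.+1} |
      [&& is_partition (parts s), sumn (parts s) == n
        & is_regular l (parts s)]]|.

(* A k-multipartition of n is an ordered k-tuple of (possibly empty)
   partitions whose sizes add up to n. *)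
Definition num_multipartitions (k n : nat) : nat :=
  #|[pred f : {ffun 'I_k -> {bseq n of 'I_n.+1}} |
      [forall j, is_partition (parts (f j))]
      && (\sum_(j < k) sumn (parts (f j)) == n)]|.

Definition has_natural_density (R : realType) (A : pred nat) (d : R) : Prop :=
  ((fun N : nat => (#|[pred n : 'I_N | A n]|%:R / N%:R)%R : R) @ \oo --> d)%classic.

(* Main.v *)
(* In F_2[[q]] put f = prod (1 - q^i), a = f(q) and b = f(q^5). The generating function of
   b_200 is f(q^200)/f(q) and that of p_17 is 1/f(q)^17. Jacobi triple products show that
   f and f^3 are the pentagonal and the triangular theta series; their 5-dissections give
   the modular equation a^6 + a b = q b^6. Dividing it by a expresses 1/a by powers of a
   and b, so the coefficients of 1/a in residue classes modulo 25 can be extracted, and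
     sum_m (b_200(25 m - 26) + p_17(m)) q^m = q^2 a b^6 + a^3 / f(q^5)^4.
   The last term has no exponent congruent to 2 or 4 modulo 5, and in q^2 a b^6 =
   q^2 f(q) f(q^10)^3 a nonzero coefficient forces 24 (m - 2) + 31 = x^2 + 30 y^2.
   A prime p for which -30 is not a square never divides x^2 + 30 y^2 exactly once, and
   the sum of 1/p over these primes diverges, so a sieve modulo the p^2 shows that such m
   have density zero. *)
Require Import Defs.
From HB Require Import structures.
From mathcomp Require Import all_boot all_order all_algebra all_solvable all_field.
From mathcomp Require Import all_classical all_reals all_analysis.
From mathcomp Require Import ring lra zify.

Set Implicit Arguments.
Unset Strict Implicit.
Unset Printing Implicit Defensive.

Import Order.TTheory GRing.Theory Num.Theory.
Import numFieldNormedType.Exports.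

(** * Formal power series *)

Local Open Scope ring_scope.

(** The constants 200 and 26 make the extraction close up. Over F_2 squaring is the substitution q
    -> q^2, so f(q^200) = f(q^25)^8 is a series in q^25 and passes unharmed through two extractions
    modulo 5. Moreover 25 m - 26 = 5 (5 (m - 2) + 4) + 4: the class 4 modulo 5 is extracted twice,
    and m - 2 accounts for the factor q^2. The modular equation acts in the form q b^6 / a = a^5 +
    b. Since b^6 is a series in q^5, the sections of 1/a reduce to those of a^5, which follow from
    the 5-dissection of a. The obstacle is that the classes 0 and 2 of a stay unknown series; they
    are controlled only by two relations, obtained by comparing the dissection of a^3 with that of
    the triangular series. On the arithmetic side, the symbol (-30/p) enters through Frobenius
    acting on a Gauss sum in characteristic p. Inert primes are supplied by numbers that are -1
    modulo 120: their symbol is -1, so some prime factor has symbol -1. Divergence and sparsity are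
    stated with finite sums and integer bounds, and the limit is taken only at the end. *)

Record fps (R : comNzRingType) := Fps {coefs :> nat -> R}.

Section FpsRing.
Variable R : comNzRingType.
Implicit Types s t u : fps R.

Lemma fpsP s t : s =1 t -> s = t.
Proof. by case: s t => s [t] /= /funext ->. Qed.

HB.instance Definition _ := gen_eqMixin (fps R).
HB.instance Definition _ := gen_choiceMixin (fps R).

Definition fps_add s t := Fps (fun n => s n + t n).
Definition fps_opp s := Fps (fun n => - s n).
Definition fps_mul s t := Fps (fun n => \sum_(i < n.+1) s i * t (n - i)%N).

Lemma fps_addA : associative fps_add.
Proof. by move=> s t u; apply: fpsP => n /=; rewrite addrA. Qed.
Lemma fps_addC : commutative fps_add.
Proof. by move=> s t; apply: fpsP => n /=; rewrite addrC. Qed.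
Lemma fps_add0 : left_id (Fps (fun=> 0)) fps_add.
Proof. by move=> s; apply: fpsP => n /=; rewrite add0r. Qed.
Lemma fps_addN : left_inverse (Fps (fun=> 0)) fps_opp fps_add.
Proof. by move=> s; apply: fpsP => n /=; rewrite addNr. Qed.

HB.instance Definition _ :=
  GRing.isZmodule.Build (fps R) fps_addA fps_addC fps_add0 fps_addN.

Definition trunc n s : {poly R} := \poly_(i < n) s i.

(** Up to coefficient [n] a product of series is a product of polynomials, so associativity and
    commutativity are inherited from [{poly R}] by truncation. *)
Lemma coef_fps_mul (p q : {poly R}) s t n :
    (forall i, (i <= n)%N -> s i = p`_i) -> (forall i, (i <= n)%N -> t i = q`_i) ->
  fps_mul s t n = (p * q)`_n.
Proof.
move=> sp tq; rewrite coefM; apply: eq_bigr => i _.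
by rewrite sp -1?ltnS // tq // leq_subr.
Qed.

Lemma coef_trunc N s i : (i < N)%N -> (trunc N s)`_i = s i.
Proof. by move=> ltiN; rewrite coef_poly ltiN. Qed.

Lemma fps_mulA : associative fps_mul.
Proof.
move=> s t u; apply: fpsP => n.
have tr (v : fps R) i : (i <= n)%N -> v i = (trunc n.+1 v)`_i.
  by move=> lein; rewrite coef_trunc.
rewrite (@coef_fps_mul (trunc n.+1 s) (trunc n.+1 t * trunc n.+1 u)) //; last 2 first.
- exact: tr.
- move=> i lein; apply: coef_fps_mul => j leji; exact/tr/(leq_trans leji).
rewrite mulrA; apply/esym/coef_fps_mul; last exact: tr.
move=> i lein; apply: coef_fps_mul => j leji; exact/tr/(leq_trans leji).
Qed.

Lemma fps_mulC : commutative fps_mul.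
Proof.
move=> s t; apply: fpsP => n.
have tr (v : fps R) i : (i <= n)%N -> v i = (trunc n.+1 v)`_i.
  by move=> lein; rewrite coef_trunc.
by rewrite (coef_fps_mul (tr s) (tr t)) mulrC -(coef_fps_mul (tr t) (tr s)).
Qed.

Lemma fps_mul1 : left_id (Fps (fun n => (n == 0)%:R)) fps_mul.
Proof.
move=> s; apply: fpsP => n /=; rewrite big_ord_recl /= mul1r subn0 big1 ?addr0 //.
by move=> i _; rewrite mul0r.
Qed.

Lemma fps_mulDl : left_distributive fps_mul fps_add.
Proof.
move=> s t u; apply: fpsP => n /=; rewrite -big_split /=.
by apply: eq_bigr => i _; rewrite mulrDl.
Qed.

Lemma fps_1neq0 : Fps (fun n => (n == 0)%:R) != 0 :> fps R.
Proof.
by apply/eqP => /(congr1 (fun s : fps R => s 0%N)) /= /eqP; rewrite oner_eq0.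
Qed.

HB.instance Definition _ := GRing.Zmodule_isComNzRing.Build (fps R)
  fps_mulA fps_mulC fps_mul1 fps_mulDl fps_1neq0.

Lemma coef_fpsD s t n : (s + t) n = s n + t n. Proof. by []. Qed.
Lemma coef_fpsM s t n : (s * t) n = \sum_(i < n.+1) s i * t (n - i)%N. Proof. by []. Qed.

Lemma coef_fps_sum (I : Type) (r : seq I) (P : pred I) (F : I -> fps R) n :
  (\sum_(i <- r | P i) F i) n = \sum_(i <- r | P i) F i n.
Proof. by elim/big_rec2: _ => // i x y _ <-. Qed.

Definition mono e : fps R := Fps (fun n => (n == e)%:R).

Arguments mono e%_N.

Lemma coef_monoM e s n : (mono e * s) n = if (e <= n)%N then s (n - e)%N else 0.
Proof.
rewrite coef_fpsM; case: leqP => [len|ltn].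
  rewrite (bigD1 (Ordinal (n := n.+1) (m := e) len)) //= eqxx mul1r big1 ?addr0 //.
  by move=> i /eqP ne; case: eqP => [ie|]; rewrite ?mul0r //; case: ne; apply: val_inj.
rewrite big1 // => i _ /=; case: eqP => [ie|]; rewrite ?mul0r //.
by have := ltn_ord i; rewrite ie ltnS leqNgt ltn.
Qed.

Lemma mono0 : mono 0 = 1. Proof. by []. Qed.

Lemma monoD d e : mono (d + e) = mono d * mono e.
Proof.
apply: fpsP => n; rewrite coef_monoM /=; case: leqP => h.
  by congr ((_ : bool)%:R); lia.
by case: eqP => //; lia.
Qed.

Lemma monoM d n : mono (d * n) = mono d ^+ n.
Proof. by elim: n => [|n IHn]; rewrite (muln0, mulnS) // monoD IHn exprS. Qed.

Lemma mono_inj e s t : mono e * s = mono e * t -> s = t.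
Proof.
move=> /(congr1 (fun u : fps R => coefs u)) /funeqP eq_st; apply: fpsP => n.
by have := eq_st (e + n)%N; rewrite !coef_monoM leq_addr addKn.
Qed.

Definition eqmod L s t := forall n, (n < L)%N -> s n = t n.

Arguments eqmod L%_N s t.

Lemma eqmod_sym L s t : eqmod L s t -> eqmod L t s.
Proof. by move=> st n /st. Qed.
Lemma eqmod_trans L s t u : eqmod L s t -> eqmod L t u -> eqmod L s u.
Proof. by move=> st tu n ltnL; rewrite st ?tu. Qed.
Lemma eqmod_leq L L' s t : (L <= L')%N -> eqmod L' s t -> eqmod L s t.
Proof. by move=> leL st n ltnL; apply: st; apply: leq_trans leL. Qed.
Lemma eqmodD L s s' t t' : eqmod L s s' -> eqmod L t t' -> eqmod L (s + t) (s' + t').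
Proof. by move=> ss tt n ltnL; rewrite !coef_fpsD ss ?tt. Qed.

Lemma eqmodM L s s' t t' : eqmod L s s' -> eqmod L t t' -> eqmod L (s * t) (s' * t').
Proof.
move=> ss tt n ltnL; rewrite !coef_fpsM; apply: eq_bigr => i _.
by rewrite ss ?tt //; have := ltn_ord i; lia.
Qed.

Lemma eqmod_sum L (I : Type) (r : seq I) (P : pred I) (F G : I -> fps R) :
    (forall i, P i -> eqmod L (F i) (G i)) ->
  eqmod L (\sum_(i <- r | P i) F i) (\sum_(i <- r | P i) G i).
Proof. by move=> FG n ltnL; rewrite !coef_fps_sum; apply: eq_bigr => i /FG; apply. Qed.

Lemma eqmod_prod1 L (I : eqType) (r : seq I) (P : pred I) (F : I -> fps R) :
    (forall i, i \in r -> P i -> eqmod L (F i) 1) ->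
  eqmod L (\prod_(i <- r | P i) F i) 1.
Proof.
move=> F1; rewrite big_seq_cond; apply: (big_ind (fun s => eqmod L s 1)) => //.
  by move=> s t s1 t1; rewrite -[1]mul1r; apply: eqmodM.
by move=> i /andP[]; apply: F1.
Qed.

Lemma eqmodX L s t n : eqmod L s t -> eqmod L (s ^+ n) (t ^+ n).
Proof. by move=> st; elim: n => // n IHn; rewrite !exprS; apply: eqmodM. Qed.

Lemma eqmod_mono L e s t : eqmod L s t -> eqmod (e + L) (mono e * s) (mono e * t).
Proof. by move=> st n ltnL; rewrite !coef_monoM; case: leqP => // h; apply: st; lia. Qed.

(** Strong induction on the coefficient: as [u 0 = 1], coefficient n of [u * s] is [s n] plus terms
    in earlier coefficients of [s]. This cancellation plays the part of division. *)
Lemma eqmod_mul_inj L u s t :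
  u 0%N = 1 -> eqmod L (u * s) (u * t) -> eqmod L s t.
Proof.
move=> u0 ust n; elim/ltn_ind: n => n IHn ltnL.
have := ust n ltnL; rewrite !coef_fpsM !big_ord_recl /= !subn0 u0 !mul1r.
rewrite (eq_bigr (fun i : 'I_n => u (bump 0 i) * t (n - bump 0 i)%N)); last first.
  move=> i _; rewrite IHn // /bump /=; have := ltn_ord i; lia.
exact: addIr.
Qed.

Lemma fps_mul_inj u s t : u 0%N = 1 -> u * s = u * t -> s = t.
Proof.
by move=> u0 ust; apply: fpsP => n; apply: (eqmod_mul_inj (L := n.+1) u0); rewrite ?ust.
Qed.

Lemma coef0M s t : (s * t) 0%N = s 0%N * t 0%N.
Proof. by rewrite coef_fpsM big_ord1. Qed.

Lemma coef0X s n : (s ^+ n) 0%N = s 0%N ^+ n.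
Proof. by elim: n => // n IHn; rewrite !exprS coef0M IHn. Qed.

(** * Coefficientwise limits, infinite sums and products *)

Definition converges (P : nat -> fps R) s :=
  forall L, exists m0, forall m, (m0 <= m)%N -> eqmod L (P m) s.

(** Identities between infinite products or sums are proved by showing that both sides are limits of
    the same finite expressions. *)
Lemma converges_uniq P s t : converges P s -> converges P t -> s = t.
Proof.
move=> Ps Pt; apply: fpsP => n.
have [m1 h1] := Ps n.+1; have [m2 h2] := Pt n.+1.
by rewrite -(h1 (maxn m1 m2)) ?leq_maxl // (h2 (maxn m1 m2)) ?leq_maxr.
Qed.

Lemma converges_cst s : converges (fun=> s) s.
Proof. by move=> L; exists 0%N. Qed.

Lemma eq_converges P Q s : P =1 Q -> converges P s -> converges Q s.
Proof. by move=> PQ Ps L; have [m0 h] := Ps L; exists m0 => m /h; rewrite PQ. Qed.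

Lemma convergesD P Q s t :
  converges P s -> converges Q t -> converges (fun m => P m + Q m) (s + t).
Proof.
move=> Ps Qt L; have [m1 h1] := Ps L; have [m2 h2] := Qt L; exists (maxn m1 m2) => m.
by rewrite geq_max => /andP[? ?]; apply: eqmodD; [apply: h1 | apply: h2].
Qed.

Lemma convergesM P Q s t :
  converges P s -> converges Q t -> converges (fun m => P m * Q m) (s * t).
Proof.
move=> Ps Qt L; have [m1 h1] := Ps L; have [m2 h2] := Qt L; exists (maxn m1 m2) => m.
by rewrite geq_max => /andP[? ?]; apply: eqmodM; [apply: h1 | apply: h2].
Qed.

Lemma converges_sum (I : Type) (r : seq I) (C : pred I) (P : I -> nat -> fps R) (s : I -> fps R) :
    (forall i, converges (P i) (s i)) ->
  converges (fun m => \sum_(i <- r | C i) P i m) (\sum_(i <- r | C i) s i).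
Proof.
move=> Ps; elim: r => [|i r IHr].
  by apply: eq_converges (converges_cst _) => m; rewrite !big_nil.
have: converges (fun m => (if C i then P i m else 0) + \sum_(i <- r | C i) P i m)
    ((if C i then s i else 0) + \sum_(i <- r | C i) s i).
  by apply: convergesD => //; case: (C i) => //; apply: converges_cst.
rewrite big_cons; case: ifP => Ci; rewrite ?add0r;
  by apply: eq_converges => m; rewrite big_cons Ci ?add0r.
Qed.

Lemma converges_sub P s k : (0 < k)%N -> converges P s -> converges (fun m => P (k * m)%N) s.
Proof. by move=> k0 Ps L; have [m0 h] := Ps L; exists m0 => m lem; apply: h; nia. Qed.

Lemma converges_shift P s k : converges P s -> converges (fun m => P (m + k)%N) s.
Proof. by move=> Ps L; have [m0 h] := Ps L; exists m0 => m lem; apply: h; lia. Qed.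

(** Coefficient n is read off the first n + 1 terms, which is the whole sum when [i <= e i]; hence
    this side condition below. [prodq] works likewise for factors that are 1 modulo q^(i + 1). *)
Definition sumq (e : nat -> nat) : fps R :=
  Fps (fun n => (\sum_(i < n.+1) mono (e i)) n).

Lemma sumq_cvg (e : nat -> nat) : (forall i, (i <= e i)%N) ->
  converges (fun m => \sum_(i < m) mono (e i)) (sumq e).
Proof.
move=> lee L; exists L => m leLm n ltnL /=.
rewrite -!(big_mkord xpredT (fun i => mono (e i))).
rewrite (big_cat_nat (n := n.+1)) //=; last exact: leq_trans leLm.
rewrite [X in _ + X]coef_fps_sum [X in _ + X]big_nat [X in _ + X]big1 ?addr0 //.
move=> i /andP[ltni _] /=.
by case: eqP => // nei; have := lee i; lia.
Qed.

Definition prodq (F : nat -> fps R) : fps R := Fps (fun n => (\prod_(i < n.+1) F i) n).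

(** The omitted factors are 1 modulo q^(k (m + 1)). The explicit precision, with its factor [k],
    feeds the estimate of Gaussian binomials. *)
Lemma eqmod_prodq (F : nat -> fps R) k m : (0 < k)%N ->
    (forall i, eqmod (k * i.+1) (F i) 1) ->
  eqmod (k * m.+1) (\prod_(i < m) F i) (prodq F).
Proof.
move=> k0 F1 n ltn /=; rewrite -!(big_mkord xpredT F).
have cut a b : (a <= b)%N -> (n < k * a.+1)%N ->
    (\prod_(0 <= i < b) F i) n = (\prod_(0 <= i < a) F i) n.
  move=> leab lta; rewrite (big_cat_nat (n := a)) //= -[in RHS](mulr1 (\prod_(0 <= i < a) F i)).
  apply: (eqmodM (L := n.+1)) => //; apply: eqmod_prod1 => i.
  by rewrite mem_index_iota => /andP[lei _] _; apply: eqmod_leq (F1 i); nia.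
by case: (leqP m n.+1) => h; [rewrite -(cut m n.+1) | rewrite (cut n.+1 m) //; nia].
Qed.

Lemma prodq_cvg (F : nat -> fps R) : (forall i, eqmod i.+1 (F i) 1) ->
  converges (fun m => \prod_(i < m) F i) (prodq F).
Proof.
move=> F1 L; exists L => m leLm; apply: (@eqmod_leq _ (1 * m.+1)); first lia.
by apply: eqmod_prodq => // i; rewrite mul1n.
Qed.

Definition dil k s := Fps (fun n => if (k %| n)%N then s (n %/ k)%N else 0).
Definition sec k r s := Fps (fun n => s (k * n + r)%N).

Arguments dil k%_N s.
Arguments sec k%_N r%_N s.

Lemma coef_dil k s n : dil k s n = if (k %| n)%N then s (n %/ k)%N else 0.
Proof. by []. Qed.

Lemma coef_sec k r s n : sec k r s n = s (k * n + r)%N.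
Proof. by []. Qed.

Lemma dil_mono k e : (0 < k)%N -> dil k (mono e) = mono (k * e).
Proof.
move=> k0; apply: fpsP => n /=; case: ifP => [/dvdnP[m ->]|ndv].
  by rewrite mulnK // mulnC eqn_pmul2l.
by case: eqP ndv => // ->; rewrite dvdn_mulr.
Qed.

Lemma dilD k s t : dil k (s + t) = dil k s + dil k t.
Proof. by apply: fpsP => n /=; case: ifP; rewrite ?addr0. Qed.

Lemma dil1 k : (0 < k)%N -> dil k 1 = 1.
Proof. by move=> k0; rewrite -mono0 dil_mono // muln0. Qed.

Lemma dil0 k : dil k 0 = 0.
Proof. by apply: fpsP => n /=; case: ifP. Qed.

Lemma coef_dilM k s t n : (0 < k)%N ->
  (dil k s * t) n = \sum_(j < (n %/ k).+1) s j * t (n - k * j)%N.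
Proof.
move=> k0; rewrite coef_fpsM.
rewrite (bigID (fun i : 'I_n.+1 => k %| i)%N) /= [X in _ + X]big1 ?addr0; last first.
  by move=> i /negbTE ->; rewrite mul0r.
have lt_kj (j : 'I_(n %/ k).+1) : (k * j < n.+1)%N.
  have := ltn_ord j; have := leq_trunc_div n k; rewrite !ltnS; nia.
rewrite (reindex (fun j => Ordinal (lt_kj j))) /=; last first.
  exists (fun i : 'I_n.+1 => inord (i %/ k)) => [j _|i].
    by apply: val_inj; rewrite /= mulKn // inordK.
  rewrite inE => dvi; apply: val_inj; rewrite /= inordK; first by rewrite mulnC divnK.
  by rewrite ltnS leq_div2r // -ltnS.
by apply: eq_big => [j|j _]; rewrite dvdn_mulr // mulKn.
Qed.

Lemma dilM k s t : (0 < k)%N -> dil k (s * t) = dil k s * dil k t.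
Proof.
move=> k0; apply: fpsP => n; rewrite coef_dilM // /=; case: ifP => [dvn|ndv].
  apply: eq_bigr => j _.
  rewrite dvdn_subr ?dvdn_mulr // ?dvn; last by have := ltn_ord j; rewrite ltnS leq_divRL // mulnC.
  congr (_ * t _); move: (nat_of_ord j) => i; case/dvdnP: dvn => m ->.
  by rewrite mulnK // [(k * i)%N]mulnC -mulnBl mulnK.
rewrite big1 // => j _; rewrite dvdn_subl ?dvdn_mulr // ?ndv ?mulr0 //.
by have := ltn_ord j; rewrite ltnS leq_divRL // mulnC.
Qed.

Lemma dilX k s n : (0 < k)%N -> dil k (s ^+ n) = dil k s ^+ n.
Proof. by move=> k0; elim: n => [|n IHn]; rewrite ?dil1 // !exprS dilM // IHn. Qed.

Lemma dil_dil j k s : (0 < j)%N -> (0 < k)%N -> dil j (dil k s) = dil (j * k) s.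
Proof.
move=> j0 k0; apply: fpsP => n /=; case: (boolP (j %| n)%N) => [/dvdnP[m ->]|ndv].
  by rewrite mulnK // (mulnC m) dvdn_pmul2l // divnMl.
case: ifP => // dv; case/negP: ndv; apply: dvdn_trans dv; exact: dvdn_mulr.
Qed.

Lemma dil_prod k (I : Type) (r : seq I) (F : I -> fps R) : (0 < k)%N ->
  dil k (\prod_(i <- r) F i) = \prod_(i <- r) dil k (F i).
Proof.
by move=> k0; elim/big_rec2: _ => [|i x y _ <-]; rewrite ?dil1 ?dilM.
Qed.

Lemma dil_sum k (I : Type) (r : seq I) (P : pred I) (F : I -> fps R) :
  dil k (\sum_(i <- r | P i) F i) = \sum_(i <- r | P i) dil k (F i).
Proof. by elim/big_rec2: _ => [|i x y _ <-]; rewrite ?dil0 ?dilD. Qed.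

Lemma eqmod_dil k L s t : (0 < k)%N -> eqmod L s t -> eqmod (k * L) (dil k s) (dil k t).
Proof.
move=> k0 st n ltnL /=; case: ifP => // _; apply: st; rewrite ltn_divLR // mulnC //.
Qed.

Lemma converges_dil k P s : (0 < k)%N -> converges P s -> converges (fun m => dil k (P m)) (dil k s).
Proof.
move=> k0 Ps L; have [m0 h] := Ps L; exists m0 => m /h /(eqmod_dil k0).
by apply: eqmod_leq; nia.
Qed.

Lemma secD k r s t : sec k r (s + t) = sec k r s + sec k r t.
Proof. exact: fpsP. Qed.

Lemma sec0 k r : sec k r 0 = 0.
Proof. exact: fpsP. Qed.

Lemma sec_sum k r (I : Type) (l : seq I) (P : pred I) (F : I -> fps R) :
  sec k r (\sum_(i <- l | P i) F i) = \sum_(i <- l | P i) sec k r (F i).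
Proof. by elim/big_rec2: _ => [|i x y _ <-]; rewrite ?sec0 ?secD. Qed.

(** Multiplying by a series in q^k moves exponents by multiples of [k], so taking a section is
    linear over such series. *)
Lemma sec_dilM k r s t : (r < k)%N -> sec k r (dil k s * t) = s * sec k r t.
Proof.
move=> ltrk; have k0 : (0 < k)%N by apply: leq_ltn_trans ltrk.
apply: fpsP => n; rewrite coef_sec coef_dilM // coef_fpsM.
have -> : ((k * n + r) %/ k = n)%N by rewrite mulnC divnMDl // divn_small ?addn0.
apply: eq_bigr => j _; congr (_ * _); rewrite coef_sec; congr (t _).
have := ltn_ord j; nia.
Qed.

Lemma sec_dil k r s : (r < k)%N -> sec k r (dil k s) = if r == 0 then s else 0.
Proof.
move=> ltrk; rewrite -[dil k s]mulr1 sec_dilM //; case: eqP => [->|/eqP r0].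
  by rewrite -[RHS]mulr1; congr (_ * _); apply: fpsP => n /=; congr ((_ : bool)%:R); nia.
rewrite -[RHS](mulr0 s); congr (_ * _); apply: fpsP => n /=.
by case: eqP => //; lia.
Qed.

Lemma sec_mono k r e : (r < k)%N ->
  sec k r (mono e) = if (e %% k == r)%N then mono (e %/ k) else 0.
Proof.
move=> ltrk; have k0 : (0 < k)%N by apply: leq_ltn_trans ltrk.
apply: fpsP => n /=; case: ((e %% k)%N =P r) => [<-|ne] /=.
  congr ((_ : bool)%:R); apply/eqP/eqP => [E|->]; last by rewrite mulnC -divn_eq.
  by rewrite -E mulnC divnMDl // divn_small ?addn0 // ltn_pmod.
case: eqP => // E; case: ne; rewrite -E mulnC modnMDl modn_small //.
Qed.

Lemma converges_sec k r P s : (r < k)%N ->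
  converges P s -> converges (fun m => sec k r (P m)) (sec k r s).
Proof.
move=> ltrk Ps L; have [m0 h] := Ps (k * L)%N; exists m0 => m /h Pms n ltnL /=.
by apply: Pms; nia.
Qed.

Lemma sec_eq k s t : (0 < k)%N ->
  (forall r, (r < k)%N -> sec k r s = sec k r t) -> s = t.
Proof.
move=> k0 eq_st; apply: fpsP => n; have ltrk := ltn_pmod n k0.
have /(congr1 (fun u : fps R => u (n %/ k)%N)) /= := eq_st _ ltrk.
by rewrite mulnC -divn_eq.
Qed.

End FpsRing.

Arguments mono {R} e%_N.
Arguments sumq {R} e.

(** * The Jacobi triple product *)

Section QBinomial.
Variables (A : comNzRingType) (Q : A).

(** The Gaussian binomial coefficient, by a q-Pascal rule that makes sense in any commutative ring.
    Where [m' - k'] is truncated, the factor [qbin m' k'] is 0. *)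
Fixpoint qbin m k : A :=
  match m, k with
  | _, 0 => 1
  | 0, _.+1 => 0
  | m'.+1, k'.+1 => qbin m' k'.+1 + Q ^+ (m' - k') * qbin m' k'
  end.

Definition qfact m : A := \prod_(i < m) (1 - Q ^+ i.+1).

Lemma qbin0 m : qbin m 0 = 1. Proof. by case: m. Qed.

Lemma qbinS m k : qbin m.+1 k.+1 = qbin m k.+1 + Q ^+ (m - k) * qbin m k.
Proof. by []. Qed.

Lemma qbin_small m k : (m < k)%N -> qbin m k = 0.
Proof.
elim: m k => [|m IHm] [|k] //; rewrite ltnS => ltmk.
by rewrite qbinS !IHm ?mulr0 ?addr0 // (leq_trans ltmk).
Qed.

Lemma binS2 n : 'C(n.+1, 2) = ('C(n, 2) + n)%N.
Proof. by rewrite binS bin1. Qed.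

(** Cauchy's q-binomial theorem, made homogeneous in [x] and [y] so that it can be centred without
    negative exponents. *)
Lemma qbinomial (x y : A) m :
  \prod_(i < m) (y + x * Q ^+ i) =
  \sum_(k < m.+1) qbin m k * (Q ^+ 'C(k, 2) * x ^+ k * y ^+ (m - k)).
Proof.
elim: m => [|m IHm]; first by rewrite big_ord0 big_ord1 /= !mulr1.
rewrite big_ord_recr /= IHm mulrDr [RHS]big_ord_recl /=.
under [X in _ = _ + X]eq_bigr => k _ do rewrite /bump /= add1n mulrDl subSS.
rewrite big_split /= addrA; congr (_ + _).
  rewrite big_ord_recl /= qbin0 [in RHS]big_ord_recr /= qbin_small // mul0r addr0.
  rewrite mulrDl mulr_suml; congr (_ + _); first by rewrite !subn0 exprS; ring.
  apply: eq_bigr => k _; rewrite /bump /= add1n.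
  have -> : (m - k = (m - k.+1).+1)%N by have := ltn_ord k; lia.
  rewrite (exprS y); ring.
rewrite mulr_suml; apply: eq_bigr => k _.
have -> : Q ^+ m = Q ^+ (m - k) * Q ^+ k by rewrite -exprD subnK // -ltnS.
rewrite binS2 exprD (exprS x); ring.
Qed.

Lemma qfactS m : qfact m.+1 = qfact m * (1 - Q ^+ m.+1).
Proof. exact: big_ord_recr. Qed.

Lemma qbin_fact m k : (k <= m)%N -> qbin m k * (qfact k * qfact (m - k)) = qfact m.
Proof.
elim: m k => [|m IHm] [|k] //; rewrite ?qbin0 ?subn0 ?mul1r /qfact ?big_ord0 ?mul1r // -!/(qfact _).
rewrite ltnS subSS leq_eqVlt => /orP[/eqP ->|ltkm].
  by rewrite qbinS qbin_small // add0r subnn expr0 mul1r qfactS -{2}(IHm m) // subnn; ring.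
have e : (m - k = (m - k.+1).+1)%N by lia.
transitivity (qbin m k.+1 * (qfact k.+1 * qfact (m - k.+1)) * (1 - Q ^+ (m - k)) +
  Q ^+ (m - k) * (1 - Q ^+ k.+1) * (qbin m k * (qfact k * qfact (m - k)))).
  by rewrite qbinS e !qfactS; ring.
rewrite !IHm // 1?ltnW // qfactS.
have -> : Q ^+ m.+1 = Q ^+ (m - k) * Q ^+ k.+1 by rewrite -exprD; congr (_ ^+ _); lia.
ring.
Qed.

End QBinomial.

Lemma bin2D m n : 'C(m + n, 2) = ('C(m, 2) + 'C(n, 2) + m * n)%N.
Proof. by elim: n => [|n IHn]; [rewrite !addn0 muln0 addn0 | rewrite addnS !binS2 IHn; lia]. Qed.

Lemma bin2_mul2 n : ('C(n, 2) * 2 + n = n * n)%N.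
Proof. by elim: n => // n IHn; rewrite binS2; lia. Qed.

Section Jacobi.
Variable R : comNzRingType.

Lemma prod_mono (I : Type) (r : seq I) (P : pred I) (e : I -> nat) :
  \prod_(i <- r | P i) mono (e i) = mono (\sum_(i <- r | P i) e i)%N :> fps R.
Proof. by elim/big_rec2: _ => // i x y _ ->; rewrite monoD. Qed.

Lemma sum_arith m r k : (\sum_(i < m) (k * i + r) = k * 'C(m, 2) + r * m)%N.
Proof. by elim: m => [|m IHm]; [rewrite big_ord0 !muln0 | rewrite big_ord_recr /= IHm binS2; lia]. Qed.

(* The sum over all j in Z of q^(k j(j-1)/2 + r j); [thetap] gives the exponents for
   j >= 0 and [thetan] those for j = - (i + 1). *)
Definition thetap k r j := (k * 'C(j, 2) + r * j)%N.
Definition thetan k r i := (k * 'C(i.+1, 2) + (k - r) * i.+1)%N.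
Definition theta k r : fps R := sumq (thetap k r) + sumq (thetan k r).

Lemma theta_cvg k r : (0 < r < k)%N ->
  converges (fun m => \sum_(j < m.+1) (mono (thetap k r j) : fps R) + \sum_(i < m) mono (thetan k r i))
    (theta k r).
Proof.
move=> rk; apply: convergesD; last by apply: sumq_cvg => i; rewrite /thetan; nia.
have /(converges_shift 1) : converges (fun m => \sum_(j < m) mono (thetap k r j)) (@sumq R (thetap k r)).
  by apply: sumq_cvg => i; rewrite /thetap; nia.
by apply: eq_converges => m; rewrite addn1.
Qed.

(** The q-binomial theorem with 2 m factors, x = q^r and y = q^(k m). Factors of index below m yield
    1 + q^(k i + (k - r)), the others 1 + q^(k i + r), after extraction of the monomial by which
    both sides are first multiplied. *)
Lemma finite_jacobi k r m : (0 < r < k)%N ->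
  \prod_(i < m) ((1 + mono (k * i + r)) * (1 + mono (k * i + (k - r)))) =
  \sum_(j < m.+1) qbin (mono k : fps R) (m + m) (m + j) * mono (thetap k r j) +
  \sum_(i < m) qbin (mono k : fps R) (m + m) (m - i.+1) * mono (thetan k r i).
Proof.
move=> rk; apply: (@mono_inj _ (k * m * m + (k * 'C(m, 2) + r * m))%N).
transitivity (\prod_(i < m + m) (mono (k * m) + mono r * mono k ^+ i) : fps R).
  rewrite big_split_ord /= [X in _ = X * _](reindex_inj rev_ord_inj) /= big_split /= monoD -sum_arith.
  have -> : mono (k * m * m) = \prod_(i < m) mono (k * m) :> fps R.
    by rewrite (prod_mono _ _ (fun=> k * m)%N) sum_nat_const card_ord mulnC.
  rewrite -(prod_mono _ _ (fun i : 'I_m => k * i + r)%N).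
  have -> : \prod_(i < m) mono (k * i + r) = \prod_(i < m) mono (k * (m - i.+1) + r) :> fps R.
    by rewrite (reindex_inj rev_ord_inj) /=.
  rewrite mulrACA -!big_split /=; apply: eq_bigr => i _.
  rewrite [RHS]mulrC; have lti := ltn_ord i; congr (_ * _).
    rewrite mulrDr mulr1 -!monoM -!monoD; congr (_ + mono _); nia.
  rewrite mulrDr mulr1 -!monoM -!monoD addrC; congr (mono _ + mono _); nia.
rewrite qbinomial -addnS big_split_ord /= addrC mulrDr; congr (_ + _).
  rewrite mulr_sumr; apply: eq_bigr => j _.
  rewrite [RHS]mulrCA -!monoM -!monoD; congr (_ * mono _).
  rewrite bin2D /thetap subnDl; have := ltn_ord j; rewrite ltnS => /subnK.
  move: 'C(m, 2) 'C(j, 2) (m - j)%N (nat_of_ord j) => a b e l <-; lia.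
rewrite [LHS](reindex_inj rev_ord_inj) mulr_sumr; apply: eq_bigr => i _ /=.
rewrite [RHS]mulrCA -!monoM -!monoD; congr (_ * mono _).
rewrite /thetan; have := bin2_mul2 i.+1; have := bin2D (m - i.+1) i.+1.
have lti := ltn_ord i; rewrite subnK //.
move: 'C(m, 2) 'C(i.+1, 2) 'C(m - i.+1, 2) => a b c -> /(congr1 (muln k)).
move: rk => /andP[? /ltnW/subnK <-]; move: (k - r)%N => d; rewrite addnK.
move/subnK: lti; move: (m - i.+1)%N (i.+1) => e l <-.
nia.
Qed.

(** To this precision all three q-factorials agree with the infinite product [E], so the factorial
    formula becomes [qbin * E * E = E], and one [E] cancels. *)
Lemma eqmod_qbin k m K : (0 < k)%N -> (K <= m)%N ->
  eqmod (k * (minn K (m - K)).+1)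
    (qbin (mono k) m K * prodq (fun i => 1 - mono (k * i.+1))) (1 : fps R).
Proof.
move=> k0 leKm; set E := prodq _; set L := (k * _)%N.
have E1 i : eqmod (k * i.+1) (1 - mono (k * i.+1)) (1 : fps R).
  move=> n ltn; rewrite coef_fpsD /= -[RHS]addr0; congr (_ + _).
  by rewrite (_ : (n == _) = false) ?oppr0 //; lia.
have qE n : (minn K (m - K) <= n)%N -> eqmod L (qfact (mono k) n) E.
  move=> len; apply: (@eqmod_leq _ _ (k * n.+1)); first by rewrite /L; nia.
  have -> : qfact (mono k) n = \prod_(i < n) (1 - mono (k * i.+1)) :> fps R.
    by rewrite /qfact; apply: eq_bigr => i _; rewrite monoM.
  exact: eqmod_prodq.
have E0 : E 0%N = 1.
  by rewrite /E /= big_ord1; rewrite E1 //; nia.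
apply: (eqmod_mul_inj E0); rewrite mulr1 mulrCA.
apply: (@eqmod_trans _ _ _ (qfact (mono k) m)); last by apply: qE; lia.
rewrite -(qbin_fact _ leKm); apply: eqmodM => //.
by apply: eqmodM; apply: eqmod_sym; apply: qE; lia.
Qed.

Theorem jacobi_triple k r : (0 < r < k)%N ->
  converges (fun m => \prod_(i < m)
     ((1 + mono (k * i + r)) * (1 + mono (k * i + (k - r))) * (1 - mono (k * i.+1))))
    (theta k r).
Proof.
move=> rk; have k0 : (0 < k)%N by lia.
have E1 i : eqmod i.+1 (1 - mono (k * i.+1)) (1 : fps R).
  move=> n ltn; rewrite coef_fpsD /= -[RHS]addr0; congr (_ + _).
  by rewrite (_ : (n == _) = false) ?oppr0 //; nia.
have cvE := prodq_cvg E1; set E := prodq _ in cvE.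
move=> L; have [m1 h1] := cvE L; have [m2 h2] := theta_cvg rk L.
exists (maxn L (maxn m1 m2)) => m; rewrite !geq_max => /and3P[leLm lem1 lem2].
rewrite big_split /=; apply: eqmod_trans (h2 _ lem2).
apply: (@eqmod_trans _ _ _
    (\prod_(i < m) ((1 + mono (k * i + r)) * (1 + mono (k * i + (k - r)))) * E)).
  by apply: eqmodM => //; apply: h1.
rewrite finite_jacobi // mulrDl !mulr_suml; apply: eqmodD; apply: eqmod_sum => i _.
  rewrite mulrAC mulrC -[X in eqmod _ _ X]mulr1.
  have lti := ltn_ord i.
  (* For [i] near [m] the binomial is known only to low order, about k (m - i); the monomial of
     exponent [thetap k r i] restores the loss because C(i, 2) >= i - 1. *)
  have := eqmod_mono (e := thetap k r i) (eqmod_qbin k0 (_ : (m + i <= m + m)%N)).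
  move=> H; apply: eqmod_leq (H _); last lia.
  rewrite (_ : minn _ _ = (m - i)%N); last lia.
  rewrite /thetap; case: (nat_of_ord i) lti => [|[|j]] ltj; [nia|nia|].
  rewrite !binS2; nia.
rewrite mulrAC mulrC -[X in eqmod _ _ X]mulr1.
have lti := ltn_ord i.
have := eqmod_mono (e := thetan k r i) (eqmod_qbin k0 (_ : (m - i.+1 <= m + m)%N)).
move=> H; apply: eqmod_leq (H _); last lia.
rewrite (_ : minn _ _ = (m - i.+1)%N); last lia.
rewrite /thetan; case: (nat_of_ord i) lti => [|j] ltj; first nia.
rewrite !binS2; nia.
Qed.

End Jacobi.

(** * Theta series modulo 2 *)

Lemma big_ord_blocks (T : Type) (idx : T) (op : Monoid.law idx) k m (F : nat -> T) :
  \big[op/idx]_(i < k * m) F i = \big[op/idx]_(j < m) \big[op/idx]_(i < k) F (k * j + i)%N.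
Proof.
elim: m => [|m IHm]; first by rewrite muln0 !big_ord0.
by rewrite mulnS addnC big_split_ord /= IHm [RHS]big_ord_recr.
Qed.

Section Sumq.
Variable R : comNzRingType.

Lemma dil_sumq k (e : nat -> nat) : (0 < k)%N -> (forall i, (i <= e i)%N) ->
  dil k (sumq e) = sumq (fun i => k * e i)%N :> fps R.
Proof.
move=> k0 lee; apply: (@converges_uniq _ (fun m => dil k (\sum_(i < m) mono (e i)))).
  by apply: converges_dil => //; apply: sumq_cvg.
apply: eq_converges (sumq_cvg _ _) => [m|i]; last by have := lee i; nia.
by rewrite dil_sum; apply: eq_bigr => i _; rewrite dil_mono.
Qed.

(** For a quadratic exponent the residue modulo [k] depends only on the class of the index: class
    [i] has residue [s i] and contributes the series with exponents [x i]. *)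
Lemma sec_sumq k r (e : nat -> nat) (x : nat -> nat -> nat) (s : nat -> nat) :
    (r < k)%N -> (forall i, (i <= e i)%N) ->
    (forall i j, (i < k)%N -> [/\ e (k * j + i) = k * x i j + s i, s i < k & j <= x i j])%N ->
  sec k r (sumq e) = \sum_(i < k | s i == r) sumq (x i) :> fps R.
Proof.
move=> ltrk lee ex; have k0 : (0 < k)%N by apply: leq_ltn_trans ltrk.
apply: (@converges_uniq _ (fun m => sec k r (\sum_(i < k * m) mono (e i)))).
  apply: converges_sec ltrk _; apply: (converges_sub (P := fun m => \sum_(i < m) mono (e i))) => //.
  exact: sumq_cvg.
have: converges (fun m => \sum_(i < k | s i == r) \sum_(j < m) mono (x i j))
    (\sum_(i < k | s i == r) sumq (x i) : fps R).
  apply: (@converges_sum _ _ _ _ (fun (i : 'I_k) m => \sum_(j < m) mono (x i j))) => i.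
  by apply: sumq_cvg => j; have [] := ex i j (ltn_ord i).
apply: eq_converges => m.
rewrite (@big_ord_blocks _ _ _ k m (fun i => mono (e i))) [in RHS]exchange_big sec_sum /= big_mkcond.
apply: eq_bigr => i _; rewrite sec_sum.
have sm j : sec k r (mono (e (k * j + i)%N)) = if s i == r then mono (x i j) else 0 :> fps R.
  have [-> ltsk _] := ex i j (ltn_ord i).
  by rewrite sec_mono // [(k * _)%N]mulnC modnMDl modn_small // divnMDl // divn_small // addn0.
by case: ifP => sir; [|rewrite big1 //]; [apply: eq_bigr|] => j _; rewrite sm sir.
Qed.

End Sumq.

Lemma bin2_5 j : 'C(5 * j, 2) = (25 * 'C(j, 2) + 10 * j)%N.
Proof. by have := bin2_mul2 (5 * j); have := bin2_mul2 j; nia. Qed.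

Lemma bin2_5D j i : 'C(5 * j + i, 2) = (25 * 'C(j, 2) + 10 * j + 'C(i, 2) + 5 * j * i)%N.
Proof. by rewrite bin2D bin2_5. Qed.

Local Notation S := (fps 'F_2).

Lemma addss (s : S) : s + s = 0.
Proof. by apply: fpsP => n /=; rewrite addrr_pchar2 // pchar_Fp. Qed.

Lemma fps_two : 2%:R = 0 :> S. Proof. exact: addss. Qed.

Lemma opps (s : S) : - s = s.
Proof. by apply/esym/eqP; rewrite -addr_eq0 addss. Qed.

Lemma addss_eq (s t : S) : s + t = 0 -> s = t.
Proof. by move/eqP; rewrite addr_eq0 opps => /eqP. Qed.

(** Frobenius: for finite sums of monomials the cross terms double and vanish, and every series over
    F_2 is a limit of such sums. *)
Lemma fps_sqr (s : S) : s ^+ 2 = dil 2 s.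
Proof.
pose P m : S := \sum_(i < m) if s i == 0 then 0 else mono i.
have cvP : converges P s.
  move=> L; exists L => m leLm n ltnL; rewrite /P coef_fps_sum.
  rewrite (bigD1 (Ordinal (leq_trans ltnL leLm))) //= big1 => [|i ne_in].
    rewrite addr0; case: eqP => [->//|/eqP]; rewrite /= eqxx.
    by case: (s n) => [[|[|]]] // lt _; apply: val_inj.
  by case: ifP => // _ /=; case: eqP => // ni; case/eqP: ne_in; apply: val_inj.
have := converges_dil (isT : (0 < 2)%N) cvP; apply: converges_uniq.
apply: eq_converges (convergesM cvP cvP) => m; rewrite -expr2 /P.
elim: m => [|m IHm]; first by rewrite !big_ord0 dil0 expr0n.
rewrite !big_ord_recr /= dilD -IHm.
set u := \sum_(i < m) _; have -> (v : S) : (u + v) ^+ 2 = u ^+ 2 + v ^+ 2.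
  by rewrite sqrrD mulr2n addss addr0.
congr (_ + _); case: ifP => _; first by rewrite dil0 expr0n.
by rewrite dil_mono // mulnC monoM.
Qed.

(** The series f of the overview; the signs are immaterial in characteristic 2. *)
Definition euler : S := prodq (fun i => 1 + mono i.+1).

Lemma eqmod_1mono (R : comNzRingType) i e : (i < e)%N -> eqmod i.+1 (1 + mono e) (1 : fps R).
Proof.
move=> lt n ltn; rewrite coef_fpsD /= -[RHS]addr0; congr (_ + _).
by rewrite (_ : (n == _) = false) //; lia.
Qed.

Lemma euler_cvg : converges (fun m => \prod_(i < m) (1 + mono i.+1)) euler.
Proof. by apply: prodq_cvg => i; apply: eqmod_1mono. Qed.

Lemma jacobi2 k r : (0 < r < k)%N ->
  converges (fun m => \prod_(i < m)
     ((1 + mono (k * i + r)) * (1 + mono (k * i + (k - r))) * (1 + mono (k * i.+1))))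
    (theta 'F_2 k r).
Proof.
move=> /(@jacobi_triple 'F_2); apply: eq_converges => m; apply: eq_bigr => i _; by rewrite opps.
Qed.

Lemma euler_blocks k : (0 < k)%N ->
  converges (fun m => \prod_(j < m) \prod_(i < k) (1 + mono (k * j + i).+1)) euler.
Proof.
move=> k0; have := converges_sub k0 euler_cvg; apply: eq_converges => m.
by rewrite (@big_ord_blocks _ _ _ k m (fun i => 1 + mono i.+1)).
Qed.

Lemma dil_euler_cvg k : (0 < k)%N ->
  converges (fun m => \prod_(i < m) (1 + mono (k * i.+1))) (dil k euler).
Proof.
move=> k0; have := converges_dil k0 euler_cvg; apply: eq_converges => m.
by rewrite dil_prod //; apply: eq_bigr => i _; rewrite dilD dil1 // dil_mono.
Qed.

Lemma euler0 : euler 0%N = 1.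
Proof. by rewrite /euler /= big_ord1 /= addr0. Qed.

Lemma pentagonal : theta 'F_2 3 1 = euler.
Proof.
apply: converges_uniq (jacobi2 _) _ => //.
have := euler_blocks (isT : 0 < 3)%N; apply: eq_converges => m; apply: eq_bigr => j _.
rewrite !big_ord_recl big_ord0 mulr1 mulrA /=.
by congr ((1 + mono _) * (1 + mono _) * (1 + mono _)); rewrite /bump; lia.
Qed.

(** The same product with two factors exchanged. Class 1 of the pentagonal series appears in this
    indexing. *)
Lemma pentagonal2 : theta 'F_2 3 2 = euler.
Proof.
apply: converges_uniq (jacobi2 _) _ => //.
have := euler_blocks (isT : 0 < 3)%N; apply: eq_converges => m; apply: eq_bigr => j _.
rewrite !big_ord_recl big_ord0 mulr1 mulrA [X in X * _]mulrC /=.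
by congr ((1 + mono _) * (1 + mono _) * (1 + mono _)); rewrite /bump; lia.
Qed.

Lemma theta5 : theta 'F_2 5 3 * theta 'F_2 5 4 = euler * dil 5 euler.
Proof.
apply: converges_uniq (convergesM (jacobi2 _) (jacobi2 _)) _ => //.
have := convergesM (euler_blocks (isT : 0 < 5)%N) (dil_euler_cvg (isT : 0 < 5)%N).
apply: eq_converges => m; rewrite -!big_split /=; apply: eq_bigr => j _.
rewrite !big_ord_recr big_ord0 /= mul1r -!addnS mulnSr.
by rewrite -[(5 - 3)%N]/2%N -[(5 - 4)%N]/1%N; ring.
Qed.

Definition tri : S := sumq (fun n => 'C(n.+1, 2)).

Lemma leq_bin2 n : (n <= 'C(n.+1, 2))%N.
Proof. by rewrite binS2; lia. Qed.

Lemma tri_cvg : converges (fun m => \sum_(i < m) mono 'C(i.+1, 2)) tri.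
Proof. exact: sumq_cvg leq_bin2. Qed.

(** The exponents are C(2 j, 2) for j in Z: nonnegative j give C(2 j, 2), and j = -(i + 1) gives C(2
    i + 3, 2), which interleave to all triangular numbers. *)
Lemma theta4 : theta 'F_2 4 1 = tri.
Proof.
apply: converges_uniq (@theta_cvg _ 4 1 isT) _.
have /(converges_sub (isT : 0 < 2)%N) := converges_shift 1 tri_cvg.
apply: eq_converges; elim=> [|m IHm].
  by rewrite muln0 !big_ord_recr !big_ord0 /= !addr0.
rewrite mulnSr addnAC addn2 !big_ord_recr /= in IHm *; rewrite IHm.
rewrite [RHS]addrACA -addrA; congr (_ + _); rewrite /thetap /thetan.
congr (mono _ + mono _); rewrite addn1 !binS2; have := bin2D m m; rewrite addnn -mul2n;
  have := bin2_mul2 m; nia.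
Qed.

(** With x the product of the factors 1 + q^(4 i + 2), sorting exponents modulo 4 gives x f(q^4) =
    f(q^2) and [tri * x = euler]. As f(q^2) = f^2 and f(q^4) = f^4, it follows that f^2 [tri] =
    f^5. *)
Theorem euler3 : euler ^+ 3 = tri.
Proof.
pose X m : S := \prod_(i < m) (1 + mono (4 * i + 2)).
have e2 : dil 2 euler = euler ^+ 2 by rewrite fps_sqr.
have e4 : dil 4 euler = euler ^+ 4 by rewrite -[4%N]/(2 * 2)%N -dil_dil // -!fps_sqr -exprM.
pose x : S := prodq (fun i => 1 + mono (4 * i + 2)).
have cvX : converges X x by apply: prodq_cvg => i; apply: eqmod_1mono; lia.
have xe : x * euler ^+ 4 = euler ^+ 2.
  rewrite -e4 -e2; apply: converges_uniq (convergesM cvX (dil_euler_cvg (isT : 0 < 4)%N)) _.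
  have := converges_sub (isT : 0 < 2)%N (dil_euler_cvg (isT : 0 < 2)%N).
  apply: eq_converges => m; rewrite (@big_ord_blocks _ _ _ 2 m (fun i => 1 + mono (2 * i.+1))).
  rewrite -big_split /=; apply: eq_bigr => i _; rewrite !big_ord_recr big_ord0 /= mul1r.
  congr ((1 + mono _) * (1 + mono _)); lia.
have te : tri * x = euler.
  rewrite -theta4; apply: converges_uniq (convergesM (jacobi2 _) cvX) _ => //.
  have := euler_blocks (isT : 0 < 4)%N; apply: eq_converges => m.
  rewrite -big_split /=; apply: eq_bigr => i _; rewrite !big_ord_recr big_ord0 /= mul1r.
  rewrite -!addnS mulnSr -[(4 - 1)%N]/3%N; ring.
apply: (@fps_mul_inj _ (euler ^+ 2)); first by rewrite coef0X euler0 expr1n.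
have -> : euler ^+ 2 * tri = (tri * x) * euler ^+ 4 by rewrite -xe; ring.
by rewrite te -exprS -exprD.
Qed.

Lemma bin2_small : [/\ 'C(0, 2) = 0, 'C(1, 2) = 0, 'C(2, 2) = 1, 'C(3, 2) = 3 & 'C(4, 2) = 6]%N.
Proof. by []. Qed.

Lemma sec_tri r : (r < 5)%N -> sec 5 r tri =
  if r == 0%N then theta 'F_2 5 3 else if r == 1%N then theta 'F_2 5 4
  else if r == 3%N then dil 5 tri else 0.
Proof.
move=> ltr5.
(* Indices i and 4 - i modulo 5 give triangular numbers of the same residue and form the two halves
   of one bilateral theta series; index 2 stands alone with residue 3. *)
pose x i j := nth 0%N [:: thetap 5 3 j; thetap 5 4 j; 5 * 'C(j.+1, 2);
  thetan 5 4 j; thetan 5 3 j]%N i.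
rewrite (@sec_sumq _ _ _ _ x (nth 0 [:: 0; 1; 3; 1; 0]))%N //; last 2 first.
- exact: leq_bin2.
- move=> i j lti; rewrite -addnS bin2_5D /x /thetap /thetan !binS2.
  have := bin2_small; by move: i lti; do 5?[case=> [|]] => //= _ [? ? ? ? ?]; split => //; lia.
rewrite big_mkcond !big_ord_recr big_ord0 /x /= dil_sumq //; last exact: leq_bin2.
by move: r ltr5; do 5?[case=> [|]] => //= _; rewrite ?addr0 ?add0r.
Qed.

(** For pentagonal n, 24 n + 1 is a square congruent to 1 - n modulo 5, which excludes n = 3 and 4.
    If n = 1 modulo 5, this square is divisible by 25, so n = 25 n' + 1 with n' again pentagonal.
    Classes 0 and 2 are left open. *)
Lemma sec_euler r : (r < 5)%N -> (r == 1) || (2 < r)%N ->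
  sec 5 r euler = if r == 1%N then dil 5 euler else 0.
Proof.
move=> ltr5 hr; rewrite -{1}pentagonal /theta secD.
pose x i j := nth 0%N [:: 15 * 'C(j, 2) + 7 * j; 5 * thetap 3 2 j; 15 * 'C(j, 2) + 13 * j + 1;
  15 * 'C(j, 2) + 16 * j + 2; 15 * 'C(j, 2) + 19 * j + 4]%N i.
rewrite (@sec_sumq _ _ _ _ x (nth 0 [:: 0; 1; 0; 2; 2]))%N //; last 2 first.
- by move=> i; rewrite /thetap; lia.
- move=> i j lti; rewrite /x /thetap bin2_5D.
  have := bin2_small; by move: i lti; do 5?[case=> [|]] => //= _ [? ? ? ? ?]; split => //; lia.
pose y i j := nth 0%N [:: 15 * 'C(j, 2) + 11 * j; 15 * 'C(j, 2) + 14 * j + 1;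
  15 * 'C(j, 2) + 17 * j + 3; 5 * thetan 3 2 j; 15 * 'C(j, 2) + 23 * j + 8]%N i.
rewrite (@sec_sumq _ _ _ _ y (nth 0 [:: 2; 2; 0; 1; 0]))%N //; last 2 first.
- by move=> i; rewrite /thetan; lia.
- move=> i j lti; rewrite /y /thetan -addnS bin2_5D !binS2.
  have := bin2_small; by move: i lti; do 5?[case=> [|]] => //= _ [? ? ? ? ?]; split => //; lia.
rewrite !(big_mkcond (fun i : 'I_5 => nth _ _ _ == _)) !big_ord_recr !big_ord0 /x /y /=.
rewrite -pentagonal2 /theta dilD !dil_sumq //; last 2 first.
- by move=> i; rewrite /thetan; lia.
- by move=> i; rewrite /thetap; lia.
by move: r ltr5 hr; do 5?[case=> [|]] => //= _ _; rewrite ?addr0 ?add0r.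
Qed.

(** * 5-dissections and the modular equation *)

Lemma sec_monoM_dil (R : comNzRingType) k r i (s : fps R) : (r < k)%N -> (i < k)%N ->
  sec k r (mono i * dil k s) = if i == r then s else 0.
Proof.
move=> ltrk ltik; rewrite mulrC sec_dilM // sec_mono // modn_small // divn_small //.
by case: eqP => _; rewrite ?mulr0 // mono0 mulr1.
Qed.

Lemma sec0_monoM (R : comNzRingType) k i (s : fps R) : (0 < i < k)%N ->
  sec k 0 (mono i * s) = mono 1 * sec k (k - i) s.
Proof.
move=> ltik; apply: fpsP => n; rewrite coef_sec !coef_monoM coef_sec.
case: n => [|n]; first by rewrite ifF //; lia.
by rewrite ifT ?ifT //; [congr (s _)|]; nia.
Qed.

(** Together with [fps_sqr] this computes sections of squares: class 4 of p^6 from class 2 of p^3,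
    and class 0 of a^10 from that of a^5. *)
Lemma sec_dil2 (R : comNzRingType) k r (s : fps R) : odd k ->
  sec k r.*2 (dil 2 s) = dil 2 (sec k r s).
Proof.
move=> ok; apply: fpsP => n; rewrite coef_sec !coef_dil coef_sec.
have -> : (2 %| k * n + r.*2)%N = (2 %| n)%N by rewrite !dvdn2 oddD oddM odd_double ok addbF.
case: ifP => // /dvdnP[m ->]; rewrite mulnK // mulnA -muln2 -mulnDl mulnK //.
Qed.

Lemma mono_exp (R : comNzRingType) n : mono n = mono 1 ^+ n :> fps R.
Proof. by rewrite -monoM mul1n. Qed.

(** Used to add the even terms by which two sides differ over the integers, after which [ring]
    closes the goal. *)
Lemma add_ss (s t : S) : s + (t + t) = s.
Proof. by rewrite addss addr0. Qed.

(** The factor a^23 turns a^13 E^2 into (a^18 E)^2, and b^4 clears [pb]. The square contributes a^2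
    q^4 b^24, which the fourth power of the modular equation rewrites as a^26 + a^6 b^4; the last
    term cancels the one coming from p^17. *)
Lemma regular_multi_identity (R : comNzRingType) (a b q p pb E : R) : 2%:R = 0 :> R ->
    p * a = 1 -> pb * b = 1 -> a ^+ 6 + a * b = q * b ^+ 6 ->
    a ^+ 18 * E = a ^+ 12 * b ^+ 3 + q * a * b ^+ 10 ->
  a ^+ 23 * b ^+ 4 * (q ^+ 2 * (a ^+ 13 * E ^+ 2) + p ^+ 17) =
  a ^+ 23 * b ^+ 4 * (q ^+ 2 * (a * b ^+ 6) + pb ^+ 4 * a ^+ 3).
Proof.
move=> two pE pbE modular EE.
have add2 (x y : R) : x + y *+ 2 = x by rewrite -mulr_natr two mulr0 addr0.
have q4 : q ^+ 4 * b ^+ 24 = a ^+ 24 + a ^+ 4 * b ^+ 4.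
  transitivity ((q * b ^+ 6) ^+ 4); first by ring.
  rewrite -modular.
  rewrite -[RHS](add2 _ (a ^+ 19 * b *+ 2 + a ^+ 14 * b ^+ 2 *+ 3 + a ^+ 9 * b ^+ 3 *+ 2)); ring.
transitivity (q ^+ 2 * b ^+ 4 * (a ^+ 18 * E) ^+ 2 + a ^+ 6 * b ^+ 4 * (p * a) ^+ 17); first by ring.
transitivity (q ^+ 2 * a ^+ 24 * b ^+ 10 + a ^+ 26 * (pb * b) ^+ 4); last by ring.
rewrite EE pE pbE !expr1n !mulr1.
transitivity (q ^+ 2 * a ^+ 24 * b ^+ 10 + a ^+ 2 * (q ^+ 4 * b ^+ 24) + a ^+ 6 * b ^+ 4).
  rewrite -[RHS](add2 _ (q ^+ 3 * a ^+ 13 * b ^+ 17)); ring.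
rewrite q4 -[RHS](add2 _ (a ^+ 6 * b ^+ 4)); ring.
Qed.

Section Dissection.
Local Notation D := (dil 5).
Local Notation q := (mono 1).

Lemma D_M (s t : S) : D (s * t) = D s * D t. Proof. exact: dilM. Qed.
Lemma D_X (s : S) n : D (s ^+ n) = D s ^+ n. Proof. exact: dilX. Qed.
Lemma D_q : D q = q ^+ 5 :> S. Proof. by rewrite dil_mono // -monoM. Qed.
Let DE := (@dilD 'F_2 5, D_M, D_X, D_q).

Lemma sec_dissect (s0 s1 s2 s3 s4 : S) r : (r < 5)%N ->
  sec 5 r (D s0 + q * D s1 + q ^+ 2 * D s2 + q ^+ 3 * D s3 + q ^+ 4 * D s4) =
  nth 0 [:: s0; s1; s2; s3; s4] r.
Proof.
move=> ltr; rewrite !secD -!monoM !sec_monoM_dil // sec_dil //.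
by move: r ltr; do 5?[case=> [|]] => //= _; rewrite ?addr0 ?add0r.
Qed.

Local Notation a := euler.
Local Notation b := (D a).
Let al := sec 5 0 a.
Let ga := sec 5 2 a.

Lemma dil_coef0 (R : comNzRingType) k (s : fps R) : dil k s 0%N = s 0%N.
Proof. by rewrite coef_dil dvdn0 div0n. Qed.

Lemma euler_dissect : a = D al + q * D b + q ^+ 2 * D ga.
Proof.
apply: (@sec_eq _ 5) => // r ltr.
have := @sec_dissect al b ga 0 0 r ltr; rewrite dil0 !mulr0 !addr0 => ->.
by move: r ltr; do 5?[case=> [|]] => //= _; rewrite sec_euler.
Qed.

Lemma euler3_dissect :
  a ^+ 3 = D (al ^+ 3 + q * b * ga ^+ 2) + q * D (q * ga ^+ 3 + b * al ^+ 2) +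
           q ^+ 2 * D (al * b ^+ 2 + ga * al ^+ 2) + q ^+ 3 * D (b ^+ 3) +
           q ^+ 4 * D (b ^+ 2 * ga + al * ga ^+ 2).
Proof.
have sq (x y z : S) : (x + q * y + q ^+ 2 * z) ^+ 2 = x ^+ 2 + q ^+ 2 * y ^+ 2 + q ^+ 4 * z ^+ 2.
  by ring: fps_two.
rewrite exprS {1 2}euler_dissect sq !DE; ring.
Qed.

Lemma theta53E : theta 'F_2 5 3 = al ^+ 3 + q * b * ga ^+ 2.
Proof. by have /= <- := @sec_tri 0 isT; rewrite -euler3 euler3_dissect sec_dissect. Qed.
Lemma theta54E : theta 'F_2 5 4 = q * ga ^+ 3 + b * al ^+ 2.
Proof. by have /= <- := @sec_tri 1 isT; rewrite -euler3 euler3_dissect sec_dissect. Qed.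

(** Class 2 of a^3 = [tri] vanishes, while the dissection gives it as al (b^2 + al ga), and [al] has
    constant coefficient 1. *)
Lemma al_ga : al * ga = b ^+ 2.
Proof.
have al0 : al 0%N = 1 by rewrite coef_sec euler0.
apply/esym/(fps_mul_inj al0)/addss_eq.
have := @sec_tri 2 isT; rewrite -euler3 euler3_dissect sec_dissect //= => <-; ring.
Qed.

Lemma b0 : b 0%N = 1. Proof. by rewrite dil_coef0 euler0. Qed.

(** Expand a b = [theta 5 3 * theta 5 4] in [al], [ga], b: by [al_ga] the two mixed terms both equal
    q b^6 and cancel, and b divides the rest. *)
Lemma euler_al_ga : a = al ^+ 5 + q ^+ 2 * ga ^+ 5.
Proof.
apply: (fps_mul_inj b0); rewrite mulrC -theta5 theta53E theta54E; apply: addss_eq.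
transitivity (q * ((al * ga) ^+ 3 + b ^+ 2 * (al * ga) ^+ 2)); first by ring: fps_two.
rewrite al_ga; ring: fps_two.
Qed.

(* By the 5-dissections, the defect Delta of this identity satisfies
   Delta(q) = q Delta(q^5), so it vanishes. *)
Theorem euler_modular : a ^+ 6 + a * b = q * b ^+ 6.
Proof.
pose Delta := a ^+ 6 + a * b + q * b ^+ 6.
have sq (x y z : S) : (x + q * y + q ^+ 3 * z) ^+ 2 = x ^+ 2 + q ^+ 2 * y ^+ 2 + q ^+ 6 * z ^+ 2.
  by ring: fps_two.
have e3 : a ^+ 3 = D (al ^+ 3 + q * b * ga ^+ 2) + q * D (q * ga ^+ 3 + b * al ^+ 2) + q ^+ 3 * D (b ^+ 3).
  rewrite {1}euler3_dissect -[b ^+ 2]al_ga.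
  have -> : al * (al * ga) + ga * al ^+ 2 = 0 by ring: fps_two.
  have -> : al * ga * ga + al * ga ^+ 2 = 0 by ring: fps_two.
  by rewrite dil0 !mulr0 !addr0.
have DeltaE : Delta = q * D Delta.
  have z1 : (al ^+ 3 + q * b * ga ^+ 2) ^+ 2 + al * a = 0.
    rewrite {2}euler_al_ga.
    transitivity (q ^+ 2 * ga ^+ 4 * (b ^+ 2 + al * ga)); first by ring: fps_two.
    by rewrite al_ga addss mulr0.
  have z2 : (q * ga ^+ 3 + b * al ^+ 2) ^+ 2 + ga * a = 0.
    rewrite {2}euler_al_ga.
    transitivity (al ^+ 4 * (b ^+ 2 + al * ga)); first by ring: fps_two.
    by rewrite al_ga addss mulr0.
  transitivity (D ((al ^+ 3 + q * b * ga ^+ 2) ^+ 2 + al * a) + q * D Delta +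
    q ^+ 2 * D ((q * ga ^+ 3 + b * al ^+ 2) ^+ 2 + ga * a)).
    have ab : a * b = (D al + q * D b + q ^+ 2 * D ga) * b by rewrite -euler_dissect.
    have a6 : a ^+ 6 = (D (al ^+ 3 + q * b * ga ^+ 2) + q * D (q * ga ^+ 3 + b * al ^+ 2) +
        q ^+ 3 * D (b ^+ 3)) ^+ 2 by rewrite -e3 -exprM.
    rewrite {1}/Delta a6 ab sq !DE; ring.
  by rewrite z1 z2 dil0 mulr0 addr0 add0r.
apply: addss_eq; rewrite -/Delta; clearbody Delta; apply: fpsP => n; elim/ltn_ind: n => n IHn.
rewrite DeltaE coef_monoM coef_dil; case: n IHn => // n IHn /=.
by rewrite subn1 /=; case: ifP => // _; rewrite IHn // ltnS leq_div.
Qed.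

(** Writing a^5 = a a^4, where the fourth power acts termwise, class 0 is al^5 + q b^5 + q^2 ga^5,
    in which [euler_al_ga] recognizes a. *)
Lemma sec0_euler5 : sec 5 0 (a ^+ 5) = a + q * b ^+ 5.
Proof.
have q4 (x y z : S) : (x + q * y + q ^+ 2 * z) ^+ 4 = x ^+ 4 + q ^+ 4 * y ^+ 4 + q ^+ 8 * z ^+ 4.
  have sq (x' y' z' : S) : (x' + y' + z') ^+ 2 = x' ^+ 2 + y' ^+ 2 + z' ^+ 2 by ring: fps_two.
  by rewrite (exprM _ 2 2) !sq; ring.
have -> : a ^+ 5 = D (al ^+ 5 + q * b ^+ 5 + q ^+ 2 * ga ^+ 5) +
    q * D (b * al ^+ 4 + q * ga * b ^+ 4) + q ^+ 2 * D (ga * al ^+ 4) +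
    q ^+ 3 * D (q * al * ga ^+ 4) + q ^+ 4 * D (al * b ^+ 4 + q * b * ga ^+ 4).
  rewrite exprS {1 2}euler_dissect q4 !DE; ring.
by rewrite sec_dissect //= [X in _ = X + _]euler_al_ga; ring.
Qed.

Variable p : S.
Hypothesis pE : p * a = 1.

(** The reduction modulo 2 of Ramanujan's generating function for p(5n + 4). Class 0 of q p b^6 =
    a^5 + b is taken. *)
Lemma sec4_p : a ^+ 6 * sec 5 4 p = b ^+ 5.
Proof.
apply: (@mono_inj _ 1); rewrite mulrCA -(sec0_monoM (k := 5) (i := 1)) // -sec_dilM //.
have -> : D (a ^+ 6) * (q * p) = a ^+ 5 + b.
  rewrite dilX // mulrA [_ * q]mulrC -euler_modular.
  transitivity ((p * a) * (a ^+ 5 + b)); first by ring.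
  by rewrite pE mul1r.
by rewrite secD sec0_euler5 sec_dil //=; ring: fps_two.
Qed.

Lemma sec2_p3 : a ^+ 18 * sec 5 2 (p ^+ 3) = a ^+ 12 * b ^+ 3 + q * a * b ^+ 10.
Proof.
apply: (@mono_inj _ 1); rewrite mulrCA -(sec0_monoM (k := 5) (i := 3)) // -sec_dilM //.
(* The cube of a^5 + b, arranged so that class 0 of every term is known: the squared modular
   equation turns a^15 + a^5 b^2 into q^2 b^12 a^3, that is b^12 times q^2 [tri]. The two copies of
   b^2 a^5 cancel. *)
have -> : D (a ^+ 18) * (mono 3 * p ^+ 3) =
    D (a ^+ 2) * a ^+ 5 + D (a ^+ 12) * (mono 2 * tri) + D a * (a ^+ 5) ^+ 2 +
    D (a ^+ 2) * a ^+ 5 + D (a ^+ 3) * 1.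
  rewrite !D_X (mono_exp _ 3%N) (mono_exp _ 2%N).
  transitivity ((q * b ^+ 6 * p) ^+ 3); first by ring.
  have -> : q * b ^+ 6 * p = a ^+ 5 + b.
    rewrite -euler_modular; transitivity ((p * a) * (a ^+ 5 + b)); first by ring.
    by rewrite pE mul1r.
  have sqm : a ^+ 12 + a ^+ 2 * b ^+ 2 = q ^+ 2 * b ^+ 12.
    transitivity ((q * b ^+ 6) ^+ 2); last by ring.
    rewrite -euler_modular; ring: fps_two.
  rewrite -euler3; apply: addss_eq.
  transitivity (a ^+ 3 * (a ^+ 12 + a ^+ 2 * b ^+ 2 + q ^+ 2 * b ^+ 12)).
    rewrite -[RHS](add_ss _ (a ^+ 10 * b *+ 2 + a ^+ 5 * b ^+ 2 *+ 2 + b ^+ 3)); ring.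
  by rewrite sqm addss mulr0.
rewrite !secD !sec_dilM // (sec0_monoM (k := 5) (i := 2)) // sec_tri //=.
have -> : sec 5 0 ((a ^+ 5) ^+ 2) = sec 5 0 (a ^+ 5) ^+ 2.
  by rewrite !fps_sqr; exact: (@sec_dil2 _ 5 0).
rewrite sec0_euler5 -euler3 D_X.
have -> : sec 5 0 1 = 1 :> S by have := @sec_dil _ 5 0 (1 : S) isT; rewrite dil1.
rewrite -[RHS](add_ss _ (a ^+ 3 *+ 2 + a ^+ 2 * q * b ^+ 5 *+ 2)); ring.
Qed.

(** Since B = f(q^25)^8 p, class 4 of B is b^13 p^6, by [sec4_p]. As p^6 is the square of p^3, class
    4 of that is a^13 times the square of class 2 of p^3. *)
Theorem regular_multi (B : S) : B * a = dil 200 a ->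
  q ^+ 2 * sec 5 4 (sec 5 4 B) + p ^+ 17 = q ^+ 2 * (a * b ^+ 6) + D (p ^+ 4) * tri.
Proof.
move=> BE.
have B_p : B = D (b ^+ 8) * p.
  rewrite -[B]mulr1 -pE mulrCA BE mulrC; congr (_ * _).
  have dil2n (s : S) n : dil (2 ^ n) s = s ^+ (2 ^ n).
    elim: n => [|n IHn]; first by apply: fpsP => n; rewrite coef_dil dvd1n divn1.
    by rewrite expnS -dil_dil ?expn_gt0 // IHn -fps_sqr -exprM mulnC.
  rewrite -[8%N]/(2 ^ 3)%N -dil2n !dil_dil //.
have BE1 : a ^+ 6 * sec 5 4 B = D (a ^+ 13).
  by rewrite B_p sec_dilM // mulrCA sec4_p D_X -exprD.
set E := sec 5 2 (p ^+ 3); set W := sec 5 4 _.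
have WE : W = a ^+ 13 * E ^+ 2.
  rewrite /W; have -> : sec 5 4 B = D (a ^+ 13) * p ^+ 6.
    by rewrite -BE1 mulrAC -exprMn [a * p]mulrC pE expr1n mul1r.
  by rewrite sec_dilM // -[6%N]/(3 * 2)%N exprM !fps_sqr; congr (_ * _); exact: (@sec_dil2 _ 5 2).
have pb : D p * b = 1 by rewrite -dilM // pE dil1.
have EE := sec2_p3; rewrite -/E in EE.
apply: (@fps_mul_inj _ (a ^+ 23 * b ^+ 4)).
  by rewrite coef0M !coef0X euler0 b0 !expr1n mulr1.
rewrite -euler3 D_X WE; exact: (regular_multi_identity fps_two pE pb euler_modular EE).
Qed.

Corollary parity_difference (B : S) r n : B * a = dil 200 a -> (r == 2) || (r == 4) ->
  B (25 * (5 * n + r) - 26)%N + (p ^+ 17) (5 * n + r)%N = (a * b ^+ 6) (5 * n + r - 2)%N.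
Proof.
move=> BE hr; have /(congr1 (sec 5 r)) := regular_multi BE.
have [ltr5 le2r] : (r < 5)%N /\ (2 <= r)%N by case/orP: hr => /eqP ->.
rewrite !secD sec_dilM //; have -> : sec 5 r tri = 0 by case/orP: hr => /eqP ->; apply: sec_tri.
rewrite mulr0 addr0 => /(congr1 (fun s : S => s n)).
rewrite coef_fpsD !coef_sec -monoM !coef_monoM mul1n.
rewrite !(leq_trans le2r (leq_addl _ _)) !coef_sec => <-.
by congr (B _ + _); lia.
Qed.

End Dissection.

(** * Generating functions of partitions *)

Lemma sumn_count N (s : seq nat) : all (fun x => 0 < x <= N)%N s ->
  sumn s = (\sum_(i < N) count_mem i.+1 s * i.+1)%N.
Proof.
elim: s => [|x s IHs] /=; first by rewrite big1.
case/andP=> /andP[x0 lexN] /IHs ->; under [RHS]eq_bigr do rewrite mulnDl.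
rewrite big_split /=; congr (_ + _)%N.
case: x x0 lexN => // x _ ltxN.
rewrite (bigD1 (Ordinal ltxN)) //= eqxx mul1n big1 ?addn0 // => i /negbTE ne.
by rewrite eqSS -[x]/(val (Ordinal ltxN)) -val_eqE /= eq_sym in ne *; rewrite [_ == _]ne.
Qed.

Lemma partition_bounds (s : seq nat) m : is_partition s -> sumn s = m ->
  all (fun x => 0 < x <= m)%N s /\ (size s <= m)%N.
Proof.
case/andP=> _ s0 <-; elim: s s0 => //= x s IHs; rewrite inE negb_or => /andP[x0 /IHs[hs hz]].
split; last by move: x0 hz; clear; case: x => // x _ hz; rewrite addSn ltnS (leq_trans hz) // leq_addl.
apply/andP; split; first by rewrite lt0n eq_sym x0 leq_addr.
by apply: sub_all hs => y /andP[-> /leq_trans]; apply; apply: leq_addl.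
Qed.

Section Multiplicities.
Variables (a : pred nat) (N m : nat).
Hypothesis lemN : (m <= N)%N.

Definition partition_set :=
  [pred s : {bseq N of 'I_N.+1} |
    [&& is_partition (parts s), sumn (parts s) == m & all a (parts s)]].

Definition multiplicity_set :=
  [pred f : {ffun 'I_N -> 'I_N.+1} |
    [forall i : 'I_N, a i.+1 || (f i == 0%N :> nat)] && (\sum_(i < N) f i * i.+1 == m)%N].

(** Position [i] counts the parts equal to [i.+1]. On [partition_set] counts are at most [N], so
    [inord] loses nothing there. *)
Definition multiplicities (s : {bseq N of 'I_N.+1}) : {ffun 'I_N -> 'I_N.+1} :=
  [ffun i : 'I_N => inord (count_mem i.+1 (parts s))].

Lemma parts_bounds s : partition_set s ->
  all (fun x => 0 < x <= N)%N (parts s) /\ (size (parts s) <= N)%N.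
Proof.
case/and3P=> ps /eqP sm _; have [hs hz] := partition_bounds ps sm.
split; last exact: leq_trans lemN.
by apply: sub_all hs => x /andP[-> /leq_trans]; apply.
Qed.

Lemma multiplicitiesE s i : partition_set s ->
  multiplicities s i = count_mem i.+1 (parts s) :> nat.
Proof.
by move=> /parts_bounds[_ hz]; rewrite ffunE inordK // ltnS (leq_trans (count_size _ _)).
Qed.

Lemma multiplicities_inj : {in partition_set &, injective multiplicities}.
Proof.
move=> s t sP tP eq_st; apply: val_inj; apply: (inj_map val_inj); rewrite -/(parts s) -/(parts t).
have [hs _] := parts_bounds sP; have [ht _] := parts_bounds tP.
case/andP: (sP) => /andP[ss _] _; case/andP: (tP) => /andP[st _] _.
apply: (@sorted_eq _ geq) => //.
- by move=> y x z xy yz; apply: leq_trans yz xy.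
- by move=> x y; rewrite andbC => /anti_leq.
apply/allP => x; rewrite mem_cat => xst.
have : (0 < x <= N)%N by case/orP: xst; [move/(allP hs) | move/(allP ht)].
case: x {xst} => // x ltxN; apply/eqP.
by rewrite -(multiplicitiesE (Ordinal ltxN) sP) eq_st multiplicitiesE.
Qed.

Lemma multiplicities_image :
  [seq multiplicities s | s in partition_set] =i multiplicity_set.
Proof.
move=> f; apply/fintype.imageP/idP => [[s sP ->]|/andP[/forallP fa /eqP fm]].
  have [hs _] := parts_bounds sP; case/and3P: (sP) => _ /eqP sm sa.
  apply/andP; split; last first.
    by rewrite -sm (sumn_count hs); apply/eqP/eq_bigr => i _; rewrite multiplicitiesE.
  apply/forallP => i; rewrite multiplicitiesE // -leqn0 leqNgt -has_count has_pred1.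
  by case: (boolP (i.+1 \in parts s)) => [/(allP sa) ->|]; rewrite ?orbT.
pose t := sort geq (flatten [seq nseq (f i) i.+1 | i <- enum 'I_N]).
have perm_t : perm_eq t (flatten [seq nseq (f i) i.+1 | i <- enum 'I_N]).
  by rewrite perm_sort.
have mem_t x : x \in t -> exists2 i : 'I_N, x = i.+1 & (0 < f i)%N.
  rewrite (perm_mem perm_t) => /flattenP[u /mapP[i _ ->]].
  by rewrite mem_nseq => /andP[fi0 /eqP ->]; exists i.
have count_t (i : 'I_N) : count_mem i.+1 t = f i.
  rewrite (seq.permP perm_t) count_flatten sumnE !big_map -enumT big_enum /=.
  rewrite (bigD1 i) //= count_nseq /= eqxx mul1n big1 ?addn0 // => j ne.
  by rewrite count_nseq /= eqSS (negbTE (ne : j != i :> nat)).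
have t_bd : all (fun x => 0 < x <= N)%N t.
  by apply/allP => x /mem_t[i -> _]; rewrite ltn_ord.
have t_sum : sumn t = m.
  by rewrite (sumn_count t_bd) -fm; apply: eq_bigr => i _; rewrite count_t.
have t_part : is_partition t.
  apply/andP; split; first by apply: sort_sorted => x y; apply: leq_total.
  by apply/negP => /(allP t_bd).
have size_t : (size [seq inord x : 'I_N.+1 | x <- t] <= N)%N.
  by rewrite size_map; have [_ /leq_trans] := partition_bounds t_part t_sum; apply.
pose s : {bseq N of 'I_N.+1} := Bseq size_t.
have parts_s : parts s = t.
  rewrite /parts /= -map_comp -[RHS]map_id; apply/eq_in_map => x /(allP t_bd)/andP[_ lexN].
  by rewrite /= inordK.
have sP : partition_set s.
  rewrite /= parts_s t_part t_sum eqxx; apply/allP => x /mem_t[i -> fi0].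
  by have := fa i; rewrite -leqn0 leqNgt fi0 orbF.
exists s => //; apply/ffunP => i; apply: val_inj.
by rewrite /= multiplicitiesE // parts_s count_t.
Qed.

Lemma card_partition_set : #|partition_set| = #|multiplicity_set|.
Proof.
by rewrite -(card_in_image multiplicities_inj); apply: eq_card multiplicities_image.
Qed.

End Multiplicities.

Section GeneratingFunction.
Variable a : pred nat.

Definition partition_product : S := prodq (fun i => if a i.+1 then 1 + mono i.+1 else 1).

Definition bounded_partitions N : S :=
  \sum_(s : {bseq N of 'I_N.+1} | is_partition (parts s) && all a (parts s))
    mono (sumn (parts s)).

Definition partition_series : S := Fps (fun n => #|partition_set a n n|%:R).

Lemma coef_bounded_partitions N m : bounded_partitions N m = #|partition_set a N m|%:R.
Proof.
rewrite coef_fps_sum /= -sum1_card natr_sum [RHS]big_mkcond /= big_mkcond; apply: eq_bigr => s _.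
rewrite unfold_in /= [m == _]eq_sym andbCA.
by case: (is_partition _ && _); case: (_ == _).
Qed.

Lemma partition_product_factor i :
  eqmod i.+1 (if a i.+1 then 1 + mono i.+1 else 1 : S) 1.
Proof. by case: (a _) => //; apply: eqmod_1mono. Qed.

Lemma eqmod_partition_product N :
  eqmod N.+1 (\prod_(i < N) (if a i.+1 then 1 + mono i.+1 else 1)) partition_product.
Proof.
rewrite -[N.+1]mul1n; apply: eqmod_prodq => // i.
by rewrite mul1n; apply: partition_product_factor.
Qed.

(** Expanding a product of truncated geometric series over multiplicity functions gives the
    partitions. Each truncated series times its factor 1 + q^(i + 1) is 1 + q^((N + 1)(i + 1)),
    which is 1 to this order. *)
Lemma bounded_partitions_product N :
  eqmod N.+1 (bounded_partitions N * partition_product) 1.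
Proof.
pose F (i : 'I_N) (c : 'I_N.+1) : S := if a i.+1 || (c == 0%N :> nat) then mono (c * i.+1) else 0.
have bE : eqmod N.+1 (bounded_partitions N) (\prod_(i < N) \sum_(c < N.+1) F i c).
  move=> m; rewrite ltnS => lemN; rewrite coef_bounded_partitions card_partition_set //.
  rewrite bigA_distr_bigA coef_fps_sum -sum1_card natr_sum [LHS]big_mkcond /=.
  apply: eq_bigr => f _; rewrite unfold_in /=.
  case: (boolP [forall i, _]) => [/forallP fa|].
    have -> : \prod_i F i (f i) = mono (\sum_i f i * i.+1)%N.
      by rewrite -prod_mono; apply: eq_bigr => i _; rewrite /F fa.
    by rewrite /= eq_sym; case: (_ == _).
  case/forallPn => i /negbTE fi; have -> // : \prod_j F j (f j) = 0.
    by rewrite (bigD1 i) //= [F i _](_ : _ = 0) ?mul0r // /F fi.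
have bE2 : eqmod N.+1 ((\prod_(i < N) \sum_(c < N.+1) F i c) *
    \prod_(i < N) (if a i.+1 then 1 + mono i.+1 else 1)) 1.
  rewrite -big_split /=; apply: eqmod_prod1 => i _ _.
  rewrite /F; case: ifP => ai /=.
    have -> : \sum_(c < N.+1) mono (c * i.+1) = \sum_(c < N.+1) mono i.+1 ^+ c :> S.
      by apply: eq_bigr => c _; rewrite -monoM mulnC.
    rewrite mulrC [_ + mono _]addrC -[X in mono _ + X]opps -subrX1 -monoM opps addrC.
    by apply: eqmod_1mono; nia.
  rewrite mulr1 (bigD1 ord0) //= mul0n mono0 big1 ?addr0 // => c; rewrite -val_eqE /= => /negbTE ->.
  by [].
apply: eqmod_trans bE2; apply: eqmodM => //.
exact/eqmod_sym/eqmod_partition_product.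
Qed.

Lemma partition_product0 : partition_product 0%N = 1.
Proof. by rewrite -(eqmod_partition_product (N := 0)) ?big_ord0. Qed.

(** Coefficient m is counted in a type bounded by m itself; both bounds give inverses of
    [partition_product] to order m, so the count agrees with the one bounded by [N]. *)
Lemma eqmod_partition_series N : eqmod N.+1 partition_series (bounded_partitions N).
Proof.
move=> m; rewrite ltnS => lemN; rewrite /= -coef_bounded_partitions.
have : eqmod m.+1 (bounded_partitions m) (bounded_partitions N); last exact.
apply: (eqmod_mul_inj partition_product0); rewrite !(mulrC partition_product).
apply: (eqmod_trans (bounded_partitions_product (N := m))); apply: eqmod_sym.
by apply: (@eqmod_leq _ _ N.+1) => //; apply: bounded_partitions_product.
Qed.

Theorem partition_seriesP : partition_series * partition_product = 1.
Proof.
apply: fpsP => n; rewrite -(bounded_partitions_product (N := n)) //.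
by apply: (eqmodM (L := n.+1)) => //; apply: eqmod_partition_series.
Qed.

End GeneratingFunction.

Lemma euler_predT : partition_product predT = euler. Proof. by []. Qed.

Lemma regular_product l : (0 < l)%N ->
  partition_product (fun x => ~~ (l %| x)%N) * dil l euler = euler.
Proof.
move=> l0; have cv1 : converges
    (fun m => \prod_(i < m) (if ~~ (l %| i.+1)%N then 1 + mono i.+1 else 1))
    (partition_product (fun x => ~~ (l %| x)%N)).
  by apply: prodq_cvg => i; apply: (@partition_product_factor (fun x => ~~ (l %| x)%N)).
apply: (converges_uniq (convergesM (converges_sub l0 cv1) (dil_euler_cvg l0))).
have := euler_blocks l0; apply: eq_converges => m.
rewrite (@big_ord_blocks _ _ _ l m (fun i => if ~~ (l %| i.+1)%N then 1 + mono i.+1 else 1)).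
rewrite -big_split /=; apply: eq_bigr => j _.
case: l l0 cv1 => // l _ _; rewrite !big_ord_recr /=.
have -> : ((l.+1 * j + l).+1 = l.+1 * j.+1)%N by lia.
rewrite dvdn_mulr //= mulr1; congr (_ * _); apply: eq_bigr => i _.
by rewrite -addnS dvdn_addr ?dvdn_mulr // gtnNdvd // ltnS ltn_ord.
Qed.

Lemma num_regular_series l n : (num_regular_partitions l n)%:R =
  partition_series (fun x => ~~ (l %| x)%N) n.
Proof. by []. Qed.

Lemma num_multipartitions_series k n :
  (num_multipartitions k n)%:R = (partition_series predT ^+ k) n.
Proof.
rewrite (eqmodX k (eqmod_partition_series predT (N := n))) // -[in RHS](card_ord k) -prodr_const.
rewrite /bounded_partitions; under eq_bigr do rewrite big_mkcond.
rewrite bigA_distr_bigA coef_fps_sum /num_multipartitions -sum1_card natr_sum big_mkcond /=.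
apply: eq_bigr => f _; rewrite unfold_in /=; case: (boolP [forall j, _]) => [/forallP fp|].
  rewrite (eq_bigr (fun j => mono (sumn (parts (f j))))); last first.
    by move=> j _; rewrite fp all_predT.
  by rewrite prod_mono /= eq_sym; case: (_ == _).
by case/forallPn => j /negbTE fj; rewrite [X in coefs X n](_ : _ = 0) // (bigD1 j) //= fj /= mul0r.
Qed.

(** * Parity differences and the form x^2 + 30 y^2 *)

Lemma natr_F2_eq0 n : (n%:R == 0 :> 'F_2) = ~~ odd n.
Proof. by rewrite -(dvdn_pcharf (pchar_Fp (isT : prime 2))) dvdn2. Qed.

Lemma fps_mul_neq0 (s t : S) n : (s * t) n != 0 ->
  exists i j, [/\ (i + j = n)%N, s i != 0 & t j != 0].
Proof.
move=> st; case: (pickP (fun i : 'I_n.+1 => s i * t (n - i)%N != 0)) => [i|st0].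
  rewrite mulf_eq0 negb_or => /andP[si ti]; exists i, (n - i)%N; split => //.
  by rewrite subnKC // -ltnS.
by case/eqP: st; apply: big1 => i _; apply/eqP/negbFE/st0.
Qed.

Lemma sumq_neq0 (e : nat -> nat) n : (sumq e : S) n != 0 -> exists j, e j = n.
Proof.
rewrite /= coef_fps_sum => en; case: (pickP (fun j : 'I_n.+1 => e j == n)) => [j /eqP ej|en0].
  by exists j.
by case/eqP: en; apply: big1 => j _; rewrite /= eq_sym en0.
Qed.

Lemma euler_neq0 n : euler n != 0 -> exists x, (x ^ 2 = 24 * n + 1)%N.
Proof.
rewrite -pentagonal coef_fpsD => h.
have : (sumq (thetap 3 1) : S) n != 0 \/ (sumq (thetan 3 1) : S) n != 0.
  by case: (eqVneq ((sumq (thetap 3 1) : S) n) 0) h => [->|]; [rewrite add0r; right | left].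
case=> /sumq_neq0[j <-]; rewrite /thetap /thetan.
  (* For e = j (3 j - 1) / 2, 24 e + 1 = (6 j - 1)^2; j = 0 is set apart because 6 j - 1 is then
     negative. *)
  case: j => [|j]; first by exists 1%N.
  by exists (6 * j + 5)%N; have := bin2_mul2 j.+1; rewrite -mulnn; nia.
by exists (6 * j + 7)%N; have := bin2_mul2 j.+1; rewrite -mulnn; nia.
Qed.

Lemma tri_neq0 n : tri n != 0 -> exists x, (x ^ 2 = 8 * n + 1)%N.
Proof.
by case/sumq_neq0 => j <-; exists (2 * j + 1)%N; have := bin2_mul2 j.+1; rewrite -mulnn; nia.
Qed.

(** As f(q^5)^6 is [tri] at q^10, a nonzero coefficient sits at i + 10 k with i pentagonal and k
    triangular. From x^2 = 24 i + 1 and y^2 = 8 k + 1 comes x^2 + 30 y^2 = 24 (i + 10 k) + 31. *)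
Theorem parity_represented r n : (r == 2) || (r == 4) ->
    odd (num_regular_partitions 200 (25 * (5 * n + r) - 26))
      != odd (num_multipartitions 17 (5 * n + r)) ->
  exists x y, (x ^ 2 + 30 * y ^ 2 = 24 * (5 * n + r - 2) + 31)%N.
Proof.
move=> hr; rewrite negb_eqb -oddD.
have pE : partition_series predT * euler = 1 by rewrite -euler_predT partition_seriesP.
have BE : partition_series (fun x => ~~ (200 %| x)%N) * euler = dil 200 euler.
  by rewrite -{1}(@regular_product 200) // mulrA partition_seriesP mul1r.
have := parity_difference pE n BE hr.
rewrite -num_regular_series -num_multipartitions_series -natrD => E.
rewrite -[odd _]negbK -natr_F2_eq0 E.
have -> : dil 5 euler ^+ 6 = dil 10 tri.
  by rewrite -[6%N]/(3 * 2)%N exprM -!dilX // euler3 fps_sqr dil_dil.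
case/fps_mul_neq0 => i [j [<- /euler_neq0[x xE]]].
rewrite coef_dil; case: ifP => [/dvdnP[k ->]|_]; last by rewrite eqxx.
by rewrite mulnK // => /tri_neq0[y yE]; exists x, y; rewrite xE yE; lia.
Qed.

(** * Primes inert in Q(sqrt(-30)) *)

Local Open Scope nat_scope.

(* For n coprime to 120 this says that the Jacobi symbol (-30/n) = (2/n) (-3/n) (5/n)
   equals -1. *)
Definition inert_residue n :=
  ((n %% 8 == 3) || (n %% 8 == 5)) (+) (n %% 3 == 2) (+) ((n %% 5 == 2) || (n %% 5 == 3)).

Definition inert p := prime p && inert_residue p.

Lemma inert_coprime p : inert p -> coprime p 120.
Proof.
case/andP=> pr_p; rewrite prime_coprime //; apply: contraL => dv.
have : p \in primes 120 by rewrite mem_primes pr_p.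
by rewrite (_ : primes 120 = [:: 2; 3; 5]) // !inE => /or3P[] /eqP ->.
Qed.

(** The three summands are quadratic characters modulo 8, 3 and 5 in additive form; each is
    multiplicative by inspection of its table. *)
Lemma inert_residueM m n : coprime m 120 -> coprime n 120 ->
  inert_residue (m * n) = inert_residue m (+) inert_residue n.
Proof.
rewrite (_ : 120 = 8 * (3 * 5)) // !coprimeMr => /and3P[m8 m3 m5] /and3P[n8 n3 n5].
rewrite /inert_residue -(modnMm m n 8) -(modnMm m n 3) -(modnMm m n 5).
move: m8 m3 m5 n8 n3 n5.
rewrite -(coprime_modl m 8) -(coprime_modl m 3) -(coprime_modl m 5).
rewrite -(coprime_modl n 8) -(coprime_modl n 3) -(coprime_modl n 5).
have key (d : nat) (P : nat -> bool) : 0 < d ->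
   all (fun i => all (fun j => coprime i d ==> coprime j d ==>
     (P ((i * j) %% d) == P i (+) P j)) (iota 0 d)) (iota 0 d) ->
   forall i j, coprime (i %% d) d -> coprime (j %% d) d ->
     P ((i %% d * (j %% d)) %% d) = P (i %% d) (+) P (j %% d).
  move=> d0 /allP h i j cm cn.
  have := h (i %% d); rewrite mem_iota ltn_mod d0 => /(_ isT) /allP /(_ (j %% d)).
  by rewrite mem_iota ltn_mod d0 cm cn => /(_ isT) /eqP.
move=> m8 m3 m5 n8 n3 n5.
rewrite (key 8 (fun i => (i == 3) || (i == 5))) // (key 3 (fun i => i == 2)) //.
rewrite (key 5 (fun i => (i == 2) || (i == 3))) //.
by rewrite [RHS]addbACA; congr (_ (+) _); rewrite addbACA.
Qed.

Lemma inert_divisor n : 0 < n -> coprime n 120 -> inert_residue n ->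
  exists2 p, inert p & p %| n.
Proof.
elim/ltn_ind: n => n IHn n0 cn rn.
have n1 : 1 < n by case: n n0 rn {IHn cn} => [|[|]].
have pr_p := pdiv_prime n1; have /dvdnP[m nE] := pdiv_dvd n.
move: cn rn IHn; rewrite {}nE; set p := pdiv n => cn rn IHn.
move: (cn); rewrite coprimeMl => /andP[cm cp].
move: rn; rewrite inert_residueM //.
case: (boolP (inert_residue p)) => [rp _|_]; first by exists p; rewrite ?dvdn_mull // /inert pr_p.
rewrite addbF => rm.
have m0 : 0 < m by move: rm; case: (m).
have [|r ir rm'] := IHn m _ m0 cm rm; last by exists r; rewrite // dvdn_mulr.
by rewrite -[X in X < _]muln1 ltn_pmul2l // prime_gt1.
Qed.

Section GaussSum.
Local Open Scope ring_scope.

(* A square root of -30 built from an eighth root of unity, a cube root of unity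
   and a fifth root of unity. *)
Definition gauss (L : fieldType) (z : L) n :=
  (z ^+ (15 * n) + z ^+ (105 * n)) * (1 + z ^+ (40 * n) *+ 2) *
  (1 + (z ^+ (24 * n) + z ^+ (96 * n)) *+ 2).

(** The three factors are square roots of 2, -3 and 5, and replacing z by z^n multiplies them by
    (2/n), (-3/n) and (5/n). *)
Lemma gaussP (L : fieldType) (z : L) : 120.-primitive_root z ->
  gauss z 1 ^+ 2 = - 30%:R /\
  forall n, coprime n 120 -> gauss z n = (-1) ^+ inert_residue n * gauss z 1.
Proof.
move=> zP.
pose w := z ^+ 15; pose v := z ^+ 40; pose t := z ^+ 24.
have z1 : z ^+ 120 = 1 := prim_expr_order zP.
have wP : 8.-primitive_root w := dvdn_prim_root zP (isT : 8 %| 120)%N.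
have vP : 3.-primitive_root v := dvdn_prim_root zP (isT : 3 %| 120)%N.
have tP : 5.-primitive_root t := dvdn_prim_root zP (isT : 5 %| 120)%N.
have geom n (x : L) : n.-primitive_root x -> (1 < n)%N -> \sum_(i < n) x ^+ i = 0.
  move=> xP n1; have : (x - 1) * (\sum_(i < n) x ^+ i) = 0.
    by rewrite -subrX1 prim_expr_order // subrr.
  move/eqP; rewrite mulf_eq0 subr_eq0 => /orP[/eqP x1|/eqP //].
  have := prim_order_dvd xP 1; rewrite expr1 x1 eqxx dvdn1 => /eqP n1'.
  by rewrite n1' in n1.
have w4 : w ^+ 4 = -1.
  have : (w ^+ 4 - 1) * (w ^+ 4 + 1) = 0 by rewrite -subr_sqr_1 -exprM (prim_expr_order wP) subrr.
  move/eqP; rewrite mulf_eq0 subr_eq0 addr_eq0 => /orP[|/eqP //].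
  by rewrite -(prim_order_dvd wP).
have v2 : 1 + v + v ^+ 2 = 0.
  by have := geom _ _ vP isT; rewrite !big_ord_recr big_ord0 /= expr0 expr1 add0r.
have t4 : 1 + t + t ^+ 2 + t ^+ 3 + t ^+ 4 = 0.
  by have := geom _ _ tP isT; rewrite !big_ord_recr big_ord0 /= expr0 expr1 add0r.
pose g8 n := w ^+ n + w ^+ (7 * n).
pose g3 n := 1 + v ^+ n *+ 2.
pose g5 n := 1 + (t ^+ n + t ^+ (4 * n)) *+ 2.
have gE n : gauss z n = g8 n * g3 n * g5 n.
  rewrite /gauss /g8 /g3 /g5 -!exprM.
  by rewrite -[105%N]/(15 * 7)%N -[96%N]/(24 * 4)%N !mulnA.
have w8 := prim_expr_order wP; have v3 := prim_expr_order vP; have t5 := prim_expr_order tP.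
have g8m n : g8 n = g8 (n %% 8)%N by rewrite /g8 !(mulnC 7) !exprM !(expr_mod _ w8).
have g3m n : g3 n = g3 (n %% 3)%N by rewrite /g3 (expr_mod _ v3).
have g5m n : g5 n = g5 (n %% 5)%N by rewrite /g5 !(mulnC 4) !exprM !(expr_mod _ t5).
have s8 : g8 1%N ^+ 2 = 2%:R.
  have -> : g8 1%N ^+ 2 = 2%:R * (w ^+ 4) ^+ 2 + w ^+ 2 * (1 + (w ^+ 4) ^+ 3).
    by rewrite /g8 expr1; ring.
  by rewrite w4; ring.
have s3 : g3 1%N ^+ 2 = - 3%:R.
  have -> : g3 1%N ^+ 2 = 4%:R * (1 + v + v ^+ 2) - 3%:R by rewrite /g3 expr1; ring.
  by rewrite v2; ring.
have s5 : g5 1%N ^+ 2 = 5%:R.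
  have -> : g5 1%N ^+ 2 =
      4%:R * (1 + t + t ^+ 2 + t ^+ 3 + t ^+ 4) + (8%:R + 4%:R * t ^+ 3) * (t ^+ 5 - 1) + 5%:R.
    by rewrite /g5 expr1; ring.
  by rewrite t4 t5; ring.
split; first by rewrite gE !exprMn s8 s3 s5; ring.
have e8 : g8 1%N = w - w ^+ 3.
  by rewrite /g8 expr1 -[w ^+ (7 * 1)]/(w ^+ (3 + 4)) exprD w4; ring.
have sign8 n : coprime n 8 -> g8 n = (-1) ^+ ((n %% 8 == 3) || (n %% 8 == 5))%N * g8 1%N.
  rewrite -coprime_modl g8m e8 /g8; have: (n %% 8 < 8)%N by rewrite ltn_mod.
  move: (n %% 8)%N => m; do 8?[case: m => [|m]] => //= _ _.
  - by rewrite -[w ^+ (7 * 1)]/(w ^+ (3 + 4)) exprD w4 expr0 expr1; ring.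
  - by rewrite -[w ^+ (7 * 3)]/(w ^+ (1 + 4 * 5)) exprD exprM w4 expr1; ring.
  - rewrite -[w ^+ 5]/(w ^+ (1 + 4)) -[w ^+ (7 * 5)]/(w ^+ (3 + 4 * 8)).
    rewrite !exprD exprM w4 !expr1; ring.
  - rewrite -[w ^+ 7]/(w ^+ (3 + 4)) -[w ^+ (7 * 7)]/(w ^+ (1 + 4 * 12)).
    rewrite !exprD exprM w4 expr0 !expr1; ring.
have sign3 n : coprime n 3 -> g3 n = (-1) ^+ (n %% 3 == 2)%N * g3 1%N.
  rewrite -coprime_modl g3m /g3; have: (n %% 3 < 3)%N by rewrite ltn_mod.
  move: (n %% 3)%N => m; do 3?[case: m => [|m]] => //= _ _; first by rewrite expr0 mul1r.
  apply/eqP; rewrite expr1 mulN1r -addr_eq0 expr1; apply/eqP.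
  by transitivity ((1 + v + v ^+ 2) *+ 2); [ring | rewrite v2 mul0rn].
have sign5 n : coprime n 5 -> g5 n = (-1) ^+ ((n %% 5 == 2) || (n %% 5 == 3))%N * g5 1%N.
  rewrite -coprime_modl g5m /g5; have: (n %% 5 < 5)%N by rewrite ltn_mod.
  move: (n %% 5)%N => m; do 5?[case: m => [|m]] => //= _ _.
  - by rewrite expr0 mul1r.
  - rewrite -[t ^+ (4 * 2)]/(t ^+ (3 + 5)) exprD t5 !expr1.
    apply/eqP; rewrite mulN1r -addr_eq0; apply/eqP.
    by transitivity ((1 + t + t ^+ 2 + t ^+ 3 + t ^+ 4) *+ 2); [ring | rewrite t4 mul0rn].
  - rewrite -[t ^+ (4 * 3)]/(t ^+ (2 + 5 * 2)) exprD exprM t5 expr1n !expr1.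
    apply/eqP; rewrite mulN1r -addr_eq0; apply/eqP.
    by transitivity ((1 + t + t ^+ 2 + t ^+ 3 + t ^+ 4) *+ 2); [ring | rewrite t4 mul0rn].
  - by rewrite -[t ^+ (4 * 4)]/(t ^+ (1 + 5 * 3)) exprD exprM t5 expr1n expr0 !expr1; ring.
move=> n; rewrite (_ : 120 = 8 * (3 * 5))%N // !coprimeMr => /and3P[n8 n3 n5].
by rewrite !gE sign8 // sign3 // sign5 // /inert_residue !signr_addb; ring.
Qed.

(** In the field with p^totient(120) elements the multiplicative group is cyclic, of order divisible
    by 120 by Euler's theorem. *)
Lemma has_primitive_root120 p : prime p -> coprime p 120 ->
  exists (L : finFieldType) (z : L), (p \in [pchar L]) /\ 120.-primitive_root z.
Proof.
move=> pr_p cp; have [L chL cardL] := pPrimePowerField pr_p (isT : 0 < totient 120)%N.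
exists L; have n0 : (0 < #|L|.-1)%N.
  by rewrite -ltnS prednK ?finNzRing_gt1 // ltnW // finNzRing_gt1.
have : has #|L|.-1.-primitive_root [seq x <- enum L | x != 0].
  apply: has_prim_root => //.
  - apply/allP => x; rewrite mem_filter => /andP[x0 _]; rewrite unity_rootE.
    apply/eqP/(mulfI x0); rewrite mulr1 -exprS prednK ?expf_card //.
    by rewrite ltnW // finNzRing_gt1.
  - by rewrite filter_uniq // enum_uniq.
  - rewrite -(cardC1 (0 : L)) cardE /enum_mem -!filter_predI /=.
    by apply/eq_leq/congr1/eq_filter => x; rewrite !inE andbT.
case/hasP => x _ xP; exists (x ^+ (#|L|.-1 %/ 120)); split => //.
apply: dvdn_prim_root => //.
have := Euler_exp_totient cp; rewrite -cardL -subn1 => /eqP.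
by rewrite eqn_mod_dvd // ltnW // finNzRing_gt1.
Qed.

(** Let g be the square root of -30. In characteristic [p], g y = x or -x lies in the prime field
    and is fixed by Frobenius, which however sends g to -g. So 2 g y = 0, where 2 and g are nonzero
    because [p] is coprime to 120. *)
Lemma inert_dvd p x y : inert p -> (p %| x ^ 2 + 30 * y ^ 2)%N -> (p %| y)%N.
Proof.
move=> ip; have cp := inert_coprime ip; case/andP: ip => pr_p rp dv.
have [L [z [chL zP]]] := has_primitive_root120 pr_p cp.
have [g2 gsign] := gaussP zP.
have gp : gauss z 1 ^+ p = - gauss z 1.
  have := gsign p cp; rewrite rp expr1 mulN1r => <-.
  have [f [fE fM fD f1]] : exists f : L -> L, [/\ forall x, f x = x ^+ p,
      {morph f : x y / x * y}, {morph f : x y / x + y} & f 1 = 1].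
    exists (pFrobenius_aut chL).
    by split; [exact: pFrobenius_autE | exact: rmorphM | exact: rmorphD | exact: rmorph1].
  have fz k : f (z ^+ (k * 1)) = z ^+ (k * p) by rewrite muln1 fE exprM.
  by rewrite -fE /gauss !mulr2n !fM !fD f1 !fz.
have : (gauss z 1 * y%:R) ^+ 2 == x%:R ^+ 2 :> L.
  rewrite exprMn g2 -subr_eq0 -oppr_eq0.
  have -> : - (- 30%:R * y%:R ^+ 2 - x%:R ^+ 2) = (x ^ 2 + 30 * y ^ 2)%:R :> L.
    by rewrite natrD natrM !natrX; ring.
  by rewrite -(dvdn_pcharf chL).
have natrp n : n%:R ^+ p = n%:R :> L by rewrite -(pFrobenius_autE chL) rmorph_nat.
have p2 : 2%:R != 0 :> L.
  rewrite -(dvdn_pcharf chL) dvdn_prime2 //; apply: contraL cp => /eqP ->.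
  by [].
rewrite eqf_sqr => eq_gx.
have gyp : (gauss z 1 * y%:R) ^+ p = gauss z 1 * y%:R.
  case/orP: eq_gx => /eqP ->; first exact: natrp.
  by rewrite -(pFrobenius_autE chL) rmorphN rmorph_nat.
rewrite (dvdn_pcharf chL).
have : gauss z 1 * y%:R *+ 2 == 0 by rewrite mulr2n -{1}gyp exprMn gp natrp mulNr addNr.
rewrite -mulr_natr 2!mulf_eq0 (negbTE p2) orbF => /orP[/eqP g0|//].
have dv30 : (p %| 30)%N.
  by move/eqP: g2; rewrite g0 expr0n /= eq_sym oppr_eq0 -(dvdn_pcharf chL).
have : (p %| 120)%N by apply: dvdn_trans dv30 _.
by move: cp; rewrite prime_coprime // => /negbTE ->.
Qed.

End GaussSum.

(** * Divergence of the sum of reciprocals of inert primes *)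

Definition recip_sum y X : rat := (\sum_(y <= p < X | inert p) p%:R^-1)%R.

Lemma recip_sum_ge0 y X : (0 <= recip_sum y X)%R.
Proof. by apply: sumr_ge0 => p _; rewrite invr_ge0 ler0n. Qed.

Lemma recip_sum_cat y X Z : y <= X -> X <= Z ->
  recip_sum y Z = (recip_sum y X + recip_sum X Z)%R.
Proof. by move=> yX XZ; rewrite /recip_sum (big_cat_nat yX XZ). Qed.

(** Otherwise there would be K (e + 1) disjoint blocks of sum above 1/(e + 1), reaching K in
    total. *)
Lemma recip_sum_tail K : (forall X, (recip_sum 0 X < K%:R)%R) ->
  forall e : nat, exists y, forall X, (recip_sum y X <= e.+1%:R^-1)%R.
Proof.
move=> ltK e; apply: contrapT => no_y.
have big j : exists X, (j%:R * e.+1%:R^-1 <= recip_sum 0 X)%R.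
  elim: j => [|j [X jX]]; first by exists 0; rewrite mul0r recip_sum_ge0.
  have [Z ltZ] : exists Z, (e.+1%:R^-1 < recip_sum X Z)%R.
    apply: contrapT => no_Z; apply: no_y; exists X => Z.
    by rewrite leNgt; apply/negP => ltZ; apply: no_Z; exists Z.
  exists Z; have leXZ : X <= Z.
    rewrite leqNgt; apply/negP => ltZX; move: ltZ.
    by rewrite /recip_sum big_geq ?ltNge ?invr_ge0 ?ler0n // ltnW.
  by rewrite (recip_sum_cat _ leXZ) // -natr1 mulrDl mul1r lerD // ltW.
have [X] := big (K * e.+1); rewrite natrM mulfK ?pnatr_eq0 // => le_KX.
by have := ltK X; rewrite ltNge le_KX.
Qed.

Lemma sum_filter1_le (P : pred nat) X : \sum_(0 <= p < X | P p) 1 <= X.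
Proof.
rewrite -[leqRHS](subn0 X) -[leqRHS]muln1 -sum_nat_const_nat [leqLHS]big_mkcond /=.
by apply: leq_sum => p _; case: (P p).
Qed.

(** A prime p with z <= p < X contributes X/p >= 1 to the right-hand side. *)
Lemma card_inert_le z X :
  ((\sum_(0 <= p < X | inert p) 1)%:R <= z%:R + X%:R * recip_sum z X)%R.
Proof.
case: (leqP z X) => [lezX|ltXz].
  rewrite (big_cat_nat (n := z)) //= natrD lerD //.
    by rewrite ler_nat sum_filter1_le.
  rewrite natr_sum mulr_sumr big_nat_cond [leRHS]big_nat_cond ler_sum //.
  move=> p /andP[/andP[_ ltpX] /andP[pr_p _]].
  by rewrite ler_pdivlMr ?ltr0n ?prime_gt0 // mul1r ler_nat ltnW.
apply: (@le_trans _ _ z%:R%R); last by rewrite lerDl mulr_ge0 ?ler0n ?recip_sum_ge0.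
by rewrite ler_nat; apply: leq_trans (ltnW ltXz); apply: sum_filter1_le.
Qed.

(** A prime or not, [p] dividing some D (k + 1) - 1 is coprime to D, so solutions k are congruent
    modulo [p] and k %/ p separates them. *)
Lemma count_progression p D M : 0 < p -> 0 < D ->
  \sum_(k < M) (p %| D * k.+1 - 1) <= M %/ p + 1.
Proof.
move=> p0 D0; rewrite -big_mkcond /= sum1dep_card addn1 -[leqRHS]card_ord.
have lt_kp (k : 'I_M) : k %/ p < (M %/ p).+1 by rewrite ltnS leq_div2r // ltnW.
rewrite -(card_in_imset (f := fun k => Ordinal (lt_kp k))) ?max_card // => k l.
rewrite !inE => dk dl /(congr1 val) /= eq_kl; apply: val_inj => /=.
have cpD : coprime p D.
  apply: coprime_dvdl dk _; apply: (@coprime_dvdr _ (D * k.+1 - 1).+1) (coprimenS _).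
  by rewrite -subSn ?subn1 ?muln_gt0 ?D0 // dvdn_mulr.
wlog lelk : k l dk dl eq_kl / l <= k.
  by move=> wl; case: (leqP l k) => [/wl|/ltnW /wl wl']; [apply | apply/esym/wl'].
have : p %| k - l.
  rewrite -(Gauss_dvdr _ cpD).
  have -> : D * (k - l) = (D * k.+1 - 1) - (D * l.+1 - 1) by nia.
  exact: dvdn_sub.
move/dvdnP => [c kl]; have := divn_eq k p; have := divn_eq l p; rewrite eq_kl.
have := ltn_pmod k p0; have := ltn_pmod l p0.
case: c kl => [|c] kl; first by move: kl lelk; lia.
nia.
Qed.

(* The numbers 120 y! (k + 1) - 1 are -1 modulo 120, hence have an inert prime factor,
   which exceeds y; if the reciprocals of these primes had a small sum, too few of
   these numbers would be divisible by one of them. *)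
Theorem recip_inert_diverges K : exists X, (K%:R <= recip_sum 0 X)%R.
Proof.
apply: contrapT => no_X.
have {no_X} ltK X : (recip_sum 0 X < K%:R)%R.
  by rewrite ltNge; apply/negP => leK; apply: no_X; exists X.
have [y tail_y] := recip_sum_tail ltK 3.
pose D := 120 * y`!; have D0 : 0 < D by rewrite muln_gt0 fact_gt0.
have [z tail_z] := recip_sum_tail ltK (4 * D - 1).
(* With tails 1/4 from y and 1/(4 D) from z, the count below reads M <= M/4 + z + M/4, that is M <=
   2 z. *)
pose M := 2 * z + 1.
have has_inert k : k < M -> 1 <= \sum_(y <= p < D * M | inert p) (p %| D * k.+1 - 1).
  move=> ltkM; pose n := D * k.+1 - 1.
  have n0 : 0 < n by rewrite /n /D; have := fact_gt0 y; nia.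
  have nD1 : n.+1 = 120 * (y`! * k.+1) by rewrite /n mulnA -/D; nia.
  have cn : coprime n 120.
    by apply: coprime_dvdr (coprimenS n); rewrite nD1 dvdn_mulr.
  have rn : inert_residue n.
    have -> : n = 119 + (y`! * k.+1 - 1) * 120 by have := fact_gt0 y; nia.
    move: (_ - 1) => c; rewrite /inert_residue.
    have -> : (119 + c * 120) %% 8 = 7 by lia.
    have -> : (119 + c * 120) %% 3 = 2 by lia.
    by have -> : (119 + c * 120) %% 5 = 4 by lia.
  have [p ip dvp] := inert_divisor n0 cn rn.
  have [pr_p _] := andP ip.
  have ltyp : y <= p.
    rewrite leqNgt; apply/negP => /ltnW lepy.
    have : p %| n.+1 by rewrite nD1 dvdn_mull // dvdn_mulr // dvdn_fact // prime_gt0.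
    by rewrite -addn1 dvdn_addr // dvdn1 => /eqP p1; rewrite p1 in pr_p.
  have ltpD : p < D * M.
    apply: leq_ltn_trans (dvdn_leq n0 dvp) _; rewrite /n; nia.
  rewrite big_mkcond (bigD1_seq p) ?mem_index_iota ?ltyp ?iota_uniq //=.
  by rewrite ip dvp leq_addr.
have: (M%:R <= M%:R * recip_sum y (D * M) + (z%:R + (D * M)%:R * recip_sum z (D * M)) :> rat)%R.
  apply: (@le_trans _ _ (\sum_(y <= p < D * M | inert p) (M %/ p + 1))%:R%R).
    rewrite ler_nat.
    apply: (@leq_trans (\sum_(k < M) \sum_(y <= p < D * M | inert p) (p %| D * k.+1 - 1))).
      rewrite -[leqLHS](card_ord M) -sum1_card; apply: leq_sum => k _; exact: has_inert.
    rewrite exchange_big /=; apply: leq_sum => p /andP[pr_p _].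
    by apply: count_progression => //; apply: prime_gt0.
  rewrite big_split /= natrD lerD //.
    rewrite natr_sum mulr_sumr ler_sum // => p /andP[pr_p _].
    by rewrite ler_pdivlMr ?ltr0n ?prime_gt0 // -natrM ler_nat leq_trunc_div.
  apply: le_trans (card_inert_le z (D * M)); rewrite ler_nat.
  case: (leqP y (D * M)) => [leyD|/ltnW ltDy]; last by rewrite big_geq.
  by rewrite [leqRHS](big_cat_nat (n := y)) //= leq_addl.
have := tail_y (D * M); have := tail_z (D * M).
have -> : (4 * D - 1).+1 = 4 * D by lia.
set s := recip_sum y _; set t := recip_sum z _ => ht hs hM.
have {ht} : ((D * M)%:R * t <= M%:R / 4%:R :> rat)%R.
  apply: le_trans (ler_wpM2l (ler0n _ _) ht) _.
  have D0' : (D%:R != 0 :> rat)%R by rewrite pnatr_eq0 -lt0n.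
  by rewrite (natrM _ D) (natrM _ 4) le_eqVlt; apply/orP; left; apply/eqP; field.
have : (M%:R * s <= M%:R / 4%:R :> rat)%R by apply: ler_wpM2l; rewrite ?ler0n.
have : (M%:R = 2%:R * z%:R + 1 :> rat)%R by rewrite /M natrD natrM.
have := ler0n rat z.
move: hM; move: (M%:R * s)%R ((D * M)%:R * t)%R => u v; lra.
Qed.

(** * Density *)

Section Sieve.
Variable t : nat.

Definition not_exactly p n := (p %| 120 * n + t) ==> (p ^ 2 %| 120 * n + t).

Lemma not_exactly_mod p M n : p ^ 2 %| M -> not_exactly p (n %% M) = not_exactly p n.
Proof.
move=> dvM; rewrite /not_exactly.
have dv d : d %| M -> (d %| 120 * (n %% M) + t) = (d %| 120 * n + t).
  move=> dM; rewrite {2}(divn_eq n M) mulnDr -addnA [in RHS]dvdn_addr //.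
  by do 2!apply: dvdn_mull.
by rewrite !dv //; apply: dvdn_trans dvM; rewrite dvdn_exp.
Qed.

(** As 120 is invertible modulo p^2, at least p residues give multiples of p and at most one of
    these a multiple of p^2. *)
Lemma count_not_exactly p : prime p -> coprime p 120 ->
  #|[set n : 'I_(p ^ 2) | not_exactly p n]| <= p ^ 2 - p + 1.
Proof.
move=> pr_p cp; have p0 := prime_gt0 pr_p.
have inj_mod (M : nat) (i j : 'I_M) : coprime M 120 -> (120 * i + t = 120 * j + t %[mod M]) -> i = j.
  move=> cM /eqP; rewrite eqn_modDr => eq_ij; apply: val_inj.
  wlog leij : i j eq_ij / j <= i.
    by move=> wl; case: (leqP j i) => [/wl|/ltnW /wl wl']; [apply | rewrite wl' // eq_sym].
  move: eq_ij; rewrite eqn_mod_dvd ?leq_mul // -mulnBr Gauss_dvdr // => dv.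
  apply/eqP; rewrite eqn_leq leij andbT leqNgt; apply/negP => lt.
  by rewrite -subn_gt0 /= in lt; have := dvdn_leq lt dv; have := ltn_ord i => /=; lia.
have [n1 n1P] : exists n1 : 'I_p, p %| 120 * n1 + t.
  have inj_f : injective (fun i : 'I_p => Ordinal (ltn_pmod (120 * i + t) p0)).
    by move=> i j /(congr1 val) /= /inj_mod; apply.
  have [g _ gK] := injF_bij inj_f.
  by exists (g (Ordinal p0)); have := gK (Ordinal p0) => /(congr1 val) /= /eqP; rewrite /dvdn.
have lt_np (i : 'I_p) : n1 + p * i < p ^ 2.
  by have := ltn_ord n1; have := ltn_ord i; rewrite -mulnn; nia.
pose A := [set n : 'I_(p ^ 2) | p %| 120 * n + t].
pose B := [set n : 'I_(p ^ 2) | p ^ 2 %| 120 * n + t].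
have leA : p <= #|A|.
  rewrite -[leqLHS]card_ord -cardsT -(@card_imset _ _ (fun i => Ordinal (lt_np i))); last first.
    by move=> i j /(congr1 val) /= /addnI /eqP; rewrite eqn_pmul2l // => /eqP /val_inj.
  apply: subset_leq_card; apply/fintype.subsetP => _ /imsetP[i _ ->]; rewrite inE /=.
  by rewrite mulnDr addnAC dvdn_addr // mulnCA dvdn_mulr.
have leB : #|B| <= 1.
  apply/card_le1P => i; rewrite inE => iB j; rewrite !inE; apply/idP/eqP => [jB|->//].
  apply: inj_mod; first by rewrite coprimeXl.
  by rewrite (eqP iB) (eqP jB).
have -> : [set n : 'I_(p ^ 2) | not_exactly p n] = ~: A :|: B.
  by apply/setP => n; rewrite !inE /not_exactly implybE.
apply: leq_trans (leq_card_setU _ _) _; apply: leq_add leB.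
by have := cardsC A; rewrite card_ord; lia.
Qed.

Lemma count_coprime (P Q : pred nat) M1 M2 : 0 < M1 -> 0 < M2 -> coprime M1 M2 ->
    (forall n, P (n %% M1) = P n) -> (forall n, Q (n %% M2) = Q n) ->
  #|[set n : 'I_(M1 * M2) | P n && Q n]| <= #|[set n : 'I_M1 | P n]| * #|[set n : 'I_M2 | Q n]|.
Proof.
move=> M10 M20 cM Pmod Qmod; rewrite -cardsX.
pose f (n : 'I_(M1 * M2)) := (Ordinal (ltn_pmod n M10), Ordinal (ltn_pmod n M20)).
have inj_f : injective f.
  move=> i j [/eqP eq1 /eqP eq2]; apply: val_inj; apply/eqP.
  have : i == j %[mod M1 * M2] by rewrite chinese_remainder // eq1 eq2.
  by rewrite !modn_small.
rewrite -(card_imset _ inj_f); apply: subset_leq_card; apply/fintype.subsetP => _ /imsetP[n nP ->].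
by move: nP; rewrite !inE /= Pmod Qmod.
Qed.

Lemma count_sieve (F : seq nat) : uniq F -> all inert F ->
  #|[set n : 'I_(\prod_(p <- F) p ^ 2) | all (not_exactly^~ n) F]|
    <= \prod_(p <- F) (p ^ 2 - p + 1).
Proof.
elim: F => [|p F IHF] /=.
  by move=> _ _; apply: leq_trans (max_card _) _; rewrite card_ord !big_nil.
case/andP=> pF uF /andP[ip iF]; rewrite !big_cons; have [pr_p _] := andP ip.
have M0 : 0 < \prod_(q <- F) q ^ 2.
  rewrite big_seq; apply: prodn_cond_gt0 => q /(allP iF)/andP[pr_q _].
  by rewrite expn_gt0 prime_gt0.
apply: leq_trans (count_coprime (P := not_exactly p) (Q := fun n => all (not_exactly^~ n) F) _ M0 _ _ _) _.
- by rewrite expn_gt0 prime_gt0.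
- rewrite coprimeXl // coprime_sym big_seq; apply: (big_ind (coprime^~ p)).
  + exact: coprime1n.
  + by move=> x y cx cy; rewrite coprimeMl cx.
  + move=> q qF; rewrite coprimeXl // prime_coprime //; last by have /andP[] := allP iF q qF.
    by rewrite dvdn_prime2 //; [apply: contraNneq pF => <- | have /andP[] := allP iF q qF].
- by move=> n; rewrite not_exactly_mod.
- move=> n; apply: eq_in_all => q qF; apply: not_exactly_mod.
  by rewrite (big_rem q) //= dvdn_mulr.
by apply: leq_mul; [apply: count_not_exactly => //; apply: inert_coprime | apply: IHF].
Qed.

(* prod (1 - (p - 1)/p^2) <= 1 / (1 + sum 1/(2p)), cleared of denominators. *)
Lemma sieve_product (F : seq nat) : all inert F ->
  ((\prod_(p <- F) (p ^ 2 - p + 1))%:R * (2%:R + \sum_(p <- F) p%:R^-1)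
    <= 2%:R * (\prod_(p <- F) p ^ 2)%:R :> rat)%R.
Proof.
elim: F => [|p F IHF] /=; first by rewrite !big_nil addr0 mulrC.
case/andP=> /andP[pr_p _] /IHF; rewrite !big_cons !natrM.
have S0 : (0 <= \sum_(q <- F) q%:R^-1 :> rat)%R by apply: sumr_ge0 => q _; rewrite invr_ge0 ler0n.
move: (\sum_(q <- F) _)%R S0 => S S0.
move: ((\prod_(q <- F) _)%:R)%R (ler0n rat (\prod_(q <- F) (q ^ 2 - q + 1))) => G G0.
move: ((\prod_(q <- F) _)%:R)%R => M le_GM.
have p2 := prime_gt1 pr_p.
have le_p : p <= p ^ 2 by rewrite -mulnn leq_pmull // ltnW.
rewrite natrD natrB // natrX.
have : (2%:R <= p%:R :> rat)%R by rewrite ler_nat.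
move: (p%:R)%R => x x2.
have x0 : (x != 0)%R by lra.
have key : ((x ^+ 2 - x + 1) * (2%:R + (x^-1 + S)) <= x ^+ 2 * (2%:R + S))%R.
  have xV : (x^-1 <= 2%:R^-1)%R by rewrite lef_pV2 ?posrE //; lra.
  have xx : (x * x^-1 = 1)%R by rewrite mulfV.
  move: (x^-1)%R xV xx => y yV xy.
  have -> : ((x ^+ 2 - x + 1) * (2%:R + (y + S)) =
      (x ^+ 2 - x + 1) * (2%:R + S) + (x * (x * y) - x * y + y))%R by ring.
  rewrite xy; nra.
have := ler_wpM2l G0 key; have : (0 <= x ^+ 2)%R by apply: sqr_ge0.
move=> xx0; have := ler_wpM2l xx0 le_GM; lra.
Qed.

End Sieve.

Lemma count_periodic (P : pred nat) M N : 0 < M -> (forall n, P (n %% M) = P n) ->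
  \sum_(n < N) P n <= (N %/ M + 1) * \sum_(n < M) P n.
Proof.
move=> M0 Pmod; have leN : N <= M * (N %/ M + 1).
  by rewrite addn1 mulnC ltnW // ltn_ceil.
apply: (@leq_trans (\sum_(n < M * (N %/ M + 1)) P n)).
  by rewrite -!(big_mkord xpredT (fun n => nat_of_bool (P n))) [leqRHS](big_cat_nat (n := N)) //= leq_addr.
rewrite (@big_ord_blocks _ _ _ M _ (fun n => nat_of_bool (P n))) /=.
rewrite -[N %/ M + 1 in leqRHS]card_ord -sum_nat_const.
apply: leq_sum => j _; apply: eq_leq; apply: eq_bigr => i _.
by rewrite -Pmod mulnC modnMDl modn_small.
Qed.

(** An inert p dividing x^2 + 30 y^2 divides y, hence x, so p^2 divides the value: [A] lies in a
    sieved set of period M, with at most M/K elements per period. *)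
Theorem sparse_represented (t : nat) (A : pred nat) :
    (forall n, A n -> exists x y, x ^ 2 + 30 * y ^ 2 = 120 * n + t) ->
  forall K, exists M, forall N, K * \sum_(n < N) A n <= N + M.
Proof.
(* The factor 2 absorbs the 2 in [sieve_product]: G (2 + s) <= 2 M with s >= 2 K gives K G <= M. *)
move=> Arep K; have [X leX] := recip_inert_diverges (2 * K).
pose F := [seq p <- iota 0 X | inert p].
have iF : all inert F by apply: filter_all.
have uF : uniq F by rewrite filter_uniq // iota_uniq.
set M := \prod_(p <- F) p ^ 2.
have M0 : 0 < M.
  rewrite /M big_seq; apply: prodn_cond_gt0 => q /(allP iF)/andP[pr_q _].
  by rewrite expn_gt0 prime_gt0.
pose P n := all (not_exactly t ^~ n) F.
have AP n : A n -> P n.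
  move=> /Arep[x [y xyE]]; apply/allP => p /(allP iF) ip; rewrite /not_exactly -xyE.
  apply/implyP => dv; have [pr_p _] := andP ip.
  have dvy := inert_dvd ip dv; have dvx : p %| x.
    have dvy2 : p %| 30 * y ^ 2 by rewrite dvdn_mull // Euclid_dvdX // dvy.
    by move: dv; rewrite dvdn_addl // Euclid_dvdX // => /andP[].
  by apply: dvdn_add; [|apply: dvdn_mull]; apply: dvdn_exp2r.
have Pmod n : P (n %% M) = P n.
  apply: eq_in_all => q qF; apply: not_exactly_mod.
  by rewrite /M (big_rem q) //= dvdn_mulr.
have leKM : K * \prod_(p <- F) (p ^ 2 - p + 1) <= M.
  have := sieve_product iF; rewrite -/M.
  have -> : (\sum_(p <- F) p%:R^-1 = recip_sum 0 X)%R.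
    by rewrite /recip_sum big_filter /index_iota subn0.
  move: leX; rewrite natrM; set s := recip_sum 0 X; set G := \prod_(p <- F) _ => leX le_sM.
  rewrite -(ler_nat rat) natrM; have := ler_wpM2l (ler0n rat G) leX.
  have := ler0n rat G; move: le_sM; lra.
exists M => N; apply: (@leq_trans (K * ((N %/ M + 1) * \sum_(n < M) P n))).
  rewrite leq_mul2l; apply/orP; right.
  apply: leq_trans (count_periodic N M0 Pmod); apply: leq_sum => n _.
  by case: (boolP (A n)) => // /AP ->.
have leP : \sum_(n < M) P n <= \prod_(p <- F) (p ^ 2 - p + 1).
  apply: leq_trans (count_sieve t uF iF); rewrite -big_mkcond sum1_card cardsE.
  by apply: eq_leq; apply: eq_card => n; rewrite ?inE.
apply: (@leq_trans ((N %/ M + 1) * M)); last by rewrite mulnDl mul1n leq_add2r leq_trunc_div.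
by rewrite mulnCA leq_mul2l (leq_trans _ leKM) ?orbT // leq_mul2l leP orbT.
Qed.

Lemma sparse_density0 (R : realType) (A : pred nat) :
    (forall K, exists M, forall N, K * \sum_(n < N) A n <= N + M) ->
  has_natural_density A (0%R : R).
Proof.
move=> sparse; apply/cvgrPdist_lt => e e0.
(* For N >= M the count is at most 2 N / K, which K > 2 / e makes smaller than e N. *)
pose K := Num.truncn (2%:R / e)%R + 1.
have [M le_KM] := sparse K.
near=> N; have leMN : M <= N by near: N; exists M.
have N0 : 0 < N by near: N; exists 1.
have N0' : (0 < N%:R :> R)%R by rewrite ltr0n.
rewrite sub0r normrN ger0_norm ?divr_ge0 // ltr_pdivrMr //.
have := le_KM N; rewrite -(ler_nat R) natrM natrD -big_mkcond sum1_card /= => leK.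
have ltK : (2%:R / e < K%:R)%R.
  by rewrite /K addn1; apply: truncnS_gt.
have leMN' : (M%:R <= N%:R :> R)%R by rewrite ler_nat.
move: ltK; rewrite ltr_pdivrMr // => ltK.
have K0 : (0 < K%:R :> R)%R by rewrite ltr0n /K addn1.
rewrite -(ltr_pM2l K0) mulrA; apply: le_lt_trans leK _.
by apply: le_lt_trans (_ : _ <= 2%:R * N%:R)%R _; [lra | rewrite ltr_pM2r].
Unshelve. all: by end_near.
Qed.

Lemma represented_density0 (R : realType) (t : nat) (A : pred nat) :
    (forall n, A n -> exists x y, x ^ 2 + 30 * y ^ 2 = 120 * n + t) ->
  has_natural_density A (0%R : R).
Proof. by move=> Arep; apply/sparse_density0/(sparse_represented Arep). Qed.

Theorem theorem9 (R : realType) :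
  has_natural_density
    (fun n : nat =>
      odd (num_regular_partitions 200 (25 * (5 * n + 2) - 26))
      != odd (num_multipartitions 17 (5 * n + 2)))
    (0%R : R)
  /\
  has_natural_density
    (fun n : nat =>
      odd (num_regular_partitions 200 (25 * (5 * n + 4) - 26))
      != odd (num_multipartitions 17 (5 * n + 4)))
    (0%R : R).
Proof.
split.
  (* 24 (5 n + r - 2) + 31 is 120 n + 31 for r = 2 and 120 n + 79 for r = 4. *)
  apply: (@represented_density0 R 31) => n h.
  by have [x [y xyE]] := @parity_represented 2 n isT h; exists x, y; lia.
apply: (@represented_density0 R 79) => n h.
by have [x [y xyE]] := @parity_represented 4 n isT h; exists x, y; lia.
Qed.
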